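(* Let $f,g$ be pre-subgroups of $V$ with $\langle f,g\rangle=n^{-1/2}$. Then $A_{f,f}$ and $B_{g,g}$ are unital $*$-subalgebras of $\mathcal L(\mathcal H)$, and there exists a unique multiplicative unitary $W\in\mathcal L(\mathcal H\otimes\mathcal H)$ of multiplicity 1 for which $g$ is a fixed vector, $f$ is a cofixed vector, $\{(\omega\otimes\mathrm{id})(W):\omega\in\mathcal L(\mathcal H)^*\}=A_{f,f}$ and $\{(\mathrm{id}\otimes\omega)(W):\omega\in\mathcal L(\mathcal H)^*\}=B_{g,g}$.
   Context: Let $\mathcal H$ be a Hilbert space of finite dimension $n\ge1$ (inner products linear in the second variable) and $V\in\mathcal L(\mathcal H\otimes\mathcal H)$ a multiplicative unitary, i.e. a unitary with $V_{12}V_{13}V_{23}=V_{23}V_{12}$ (leg notation). $\xi$ is fixed (for a multiplicative unitary $V$) if $V(\xi\otimes\eta)=\xi\otimes\eta$ for all $\eta$, cofixed if $V(\eta\otimes\xi)=\eta\otimes\xi$ for all $\eta$; multiplicity 1 means the fixed vectors form a line (then so do cofixed vectors). Assume $V$ has multiplicity 1; fix a unit fixed vector $e$ and the unit cofixed vector $\hat e$ with $\langle e,\hat e\rangle=n^{-1/2}$. $L(\omega)=(\omega\otimes\mathrm{id})(V)$, $\rho(\omega)=(\mathrm{id}\otimes\omega)(V)$, $S=\{L(\omega)\}$, $\widehat S=\{\rho(\omega)\}$ ($\omega\in\mathcal L(\mathcal H)^*$). The map $\kappa:L(\omega)\mapsto(\omega\otimes\mathrm{id})(V^* )$ is a well-defined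 involutive antiautomorphism of $S$, and $U$ is the unitary on $\mathcal H$ with $U(xe)=\kappa(x)e$ for $x\in S$. A pre-subgroup is $f\in\mathcal H$ with $\|f\|=1$, $\langle f,e\rangle>0$, $V(f\otimes f)=f\otimes f$; $H^f=\{\eta:V(f\otimes\eta)=f\otimes\eta\}$, $H_f=\{\eta:V(\eta\otimes f)=\eta\otimes f\}$. Define $G_f=\{x\in S:xe\in H_f\}$, $D_g=\{x\in S:xe\in UH_g\}$, $\widehat D_f=\{y\in\widehat S:y\hat e\in H^f\}$, $\widehat G_g=\{y\in\widehat S: y\hat e\in UH^g\}$. Let $A_{f,f}$ be the linear span of $\{xy: x\in U\widehat D_fU,\ y\in G_f\}$ and $B_{g,g}$ the linear span of $\{xy: x\in D_g,\ y\in\widehat G_g\}$. *)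

(* Defs.v *)
From HB Require Import structures.
From mathcomp Require Import all_boot all_order all_algebra.
From mathcomp Require Import reals.
From mathcomp.real_closed Require Import complex mxtens.
Set Implicit Arguments. Unset Strict Implicit. Unset Printing Implicit Defensive.
Import Order.TTheory GRing.Theory Num.Theory.
Local Open Scope ring_scope.

Section MU.
Variable C : numClosedFieldType.
Variable n : nat.

(* H = C^n (column vectors), L(H) = 'M_n, H (x) H = C^(n*n) with the
   index of (i,j) given by mxtens_index (i,j) (as in tensmx). *)

Definition ip (x y : 'cV[C]_n) : C := \sum_(i < n) (x i 0)^* * y i 0.

Definition adj_op m (A : 'M[C]_m) : 'M[C]_m := (map_mx Num.conj A)^T.

Definition unitary_op m (A : 'M[C]_m) : Prop :=
  A *m adj_op A = 1%:M /\ adj_op A *m A = 1%:M.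

Definition tens (x y : 'cV[C]_n) : 'cV[C]_(n * n) := x *t y.

Definition idx2 (i j : 'I_n) : 'I_(n * n) := mxtens_index (i, j).

(* the three legs of an index of H (x) H (x) H = C^((n*n)*n) *)
Definition i1 (p : 'I_(n * n * n)) : 'I_n := (mxtens_unindex (mxtens_unindex p).1).1.
Definition i2 (p : 'I_(n * n * n)) : 'I_n := (mxtens_unindex (mxtens_unindex p).1).2.
Definition i3 (p : 'I_(n * n * n)) : 'I_n := (mxtens_unindex p).2.

Definition leg12 (V : 'M[C]_(n * n)) : 'M[C]_(n * n * n) :=
  \matrix_(p, q) (V (idx2 (i1 p) (i2 p)) (idx2 (i1 q) (i2 q)) * (i3 p == i3 q)%:R).
Definition leg23 (V : 'M[C]_(n * n)) : 'M[C]_(n * n * n) :=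
  \matrix_(p, q) ((i1 p == i1 q)%:R * V (idx2 (i2 p) (i3 p)) (idx2 (i2 q) (i3 q))).
Definition leg13 (V : 'M[C]_(n * n)) : 'M[C]_(n * n * n) :=
  \matrix_(p, q) ((i2 p == i2 q)%:R * V (idx2 (i1 p) (i3 p)) (idx2 (i1 q) (i3 q))).

Definition multiplicative_unitary (V : 'M[C]_(n * n)) : Prop :=
  unitary_op V /\ leg12 V *m leg13 V *m leg23 V = leg23 V *m leg12 V.

Definition fixedv (V : 'M[C]_(n * n)) (xi : 'cV[C]_n) : Prop :=
  forall eta, V *m tens xi eta = tens xi eta.
Definition cofixedv (V : 'M[C]_(n * n)) (xi : 'cV[C]_n) : Prop :=
  forall eta, V *m tens eta xi = tens eta xi.

Definition multiplicity1 (V : 'M[C]_(n * n)) : Prop :=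
  exists xi : 'cV[C]_n, xi != 0 /\
    forall zeta, fixedv V zeta <-> exists c : C, zeta = c *: xi.

(* slice maps (omega (x) id)(V) and (id (x) omega)(V) for a linear
   functional omega on L(H) *)
Definition slice_l (om : 'M[C]_n -> C) (V : 'M[C]_(n * n)) : 'M[C]_n :=
  \matrix_(k, l) om (\matrix_(i, j) V (idx2 i k) (idx2 j l)).
Definition slice_r (om : 'M[C]_n -> C) (V : 'M[C]_(n * n)) : 'M[C]_n :=
  \matrix_(i, j) om (\matrix_(k, l) V (idx2 i k) (idx2 j l)).

Definition Sset (V : 'M[C]_(n * n)) (x : 'M[C]_n) : Prop :=
  exists om : {scalar 'M[C]_n}, x = slice_l om V.
Definition hatSset (V : 'M[C]_(n * n)) (y : 'M[C]_n) : Prop :=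
  exists om : {scalar 'M[C]_n}, y = slice_r om V.

Definition presubgroup (V : 'M[C]_(n * n)) (e f : 'cV[C]_n) : Prop :=
  ip f f = 1 /\ 0 < ip f e /\ V *m tens f f = tens f f.

Definition Hup (V : 'M[C]_(n * n)) (f eta : 'cV[C]_n) : Prop :=
  V *m tens f eta = tens f eta.
Definition Hlow (V : 'M[C]_(n * n)) (f eta : 'cV[C]_n) : Prop :=
  V *m tens eta f = tens eta f.

Definition Gset V (e f : 'cV[C]_n) (x : 'M[C]_n) : Prop :=
  Sset V x /\ Hlow V f (x *m e).
Definition Dset V (e : 'cV[C]_n) (U : 'M[C]_n) (g : 'cV[C]_n) (x : 'M[C]_n) : Prop :=
  Sset V x /\ exists eta, Hlow V g eta /\ x *m e = U *m eta.
Definition hatDset V (ehat f : 'cV[C]_n) (y : 'M[C]_n) : Prop :=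
  hatSset V y /\ Hup V f (y *m ehat).
Definition hatGset V (ehat : 'cV[C]_n) (U : 'M[C]_n) (g : 'cV[C]_n) (y : 'M[C]_n) : Prop :=
  hatSset V y /\ exists eta, Hup V g eta /\ y *m ehat = U *m eta.

Definition lspan (P : 'M[C]_n -> Prop) (z : 'M[C]_n) : Prop :=
  exists s : seq (C * 'M[C]_n),
    (forall p, p \in s -> P p.2) /\ z = \sum_(p <- s) p.1 *: p.2.

Definition Aff V e ehat U f : 'M[C]_n -> Prop :=
  lspan (fun z => exists x y,
           (exists y', hatDset V ehat f y' /\ x = U *m y' *m U) /\
           Gset V e f y /\ z = x *m y).

Definition Bgg V e ehat U g : 'M[C]_n -> Prop :=
  lspan (fun z => exists x y,
           Dset V e U g x /\ hatGset V ehat U g y /\ z = x *m y).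

Definition unital_star_subalg (P : 'M[C]_n -> Prop) : Prop :=
  [/\ P 1%:M,
      forall x y, P x -> P y -> P (x + y),
      forall (c : C) x, P x -> P (c *: x),
      forall x y, P x -> P y -> P (x *m y)
    & forall x, P x -> P (adj_op x)].

End MU.

(* Main.v *)
Require Import Defs.
From HB Require Import structures.
From mathcomp Require Import all_boot all_order all_algebra.
From mathcomp Require Import reals.
From mathcomp.real_closed Require Import complex mxtens.
Set Implicit Arguments. Unset Strict Implicit. Unset Printing Implicit Defensive.
Import Order.TTheory GRing.Theory Num.Theory.
Local Open Scope ring_scope.

(** A pre-subgroup f of V gives the projections of H onto H_f and H^f, and
    <f, g> = n^(-1/2) says that these projections are complementary for f and g:
    the one of f maps g to a multiple of e, respectively of eh.  This allows one
    to cut V down to a unitary X in (right coideal of g) (x) (left coideal of f)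
    that agrees with V on all vectors z (x) g and f (x) z; such an X is unitary
    because g and f are cyclic for the commutants.  The same construction
    applied to the dual multiplicative unitary gives Y, and W = Y X.

    The slices of W satisfy (f^* (x) 1) W (z (x) g) = n^(-1/2) z.  Hence g is
    cyclic for A and f for B, so that A and B are the commutants of U A U and
    U B U, which makes them unital *-algebras.  If W (a (x) 1) W^* lies in
    A (x) A for a in A, the pentagon equation becomes an equality of operators
    determined by their values on g (x) g, where it is immediate.  For any other
    candidate the pentagon equation gives back the displayed formula, which
    determines it. *)

(** The number s = n^(-1/2) = <e, eh> is extremal. A Pythagoras argument gives s <= <e, f> <e, g>,
    and since <e, f> <eh, f> = s, the same bound for the dual is the reverse inequality. Equality is
    what complementarity means here.

    Finite dimension enters through a trace: on the commutant of S the matrix trace is n times the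
    vector state of e. This makes e cyclic for S, makes that state tracial on S, and gives that U is
    an involution carrying S onto its commutant. After that, most operator identities are proved in
    one way: both sides commute with algebras acting cyclically on some vector of each leg, so one
    vector is enough.

    The factor X alone is too small, as its second leg only sees G_f. The other half of A, the
    conjugate by U of the coideal of f in the dual, has to come from a unitary built from the dual,
    and the cube identity relating U, the flip and [V] is what makes the two factors fit
    together. *)

(** * Inner products and legs of a tensor product *)

Section InnerProduct.
Variable C : numClosedFieldType.

Lemma ipE n (x y : 'cV[C]_n) : ip x y = \sum_i (x i 0)^* * y i 0.
Proof. by []. Qed.

Lemma ipDr n (x y z : 'cV[C]_n) : ip x (y + z) = ip x y + ip x z.
Proof. by rewrite !ipE -big_split; apply: eq_bigr => i _; rewrite mxE mulrDr. Qed.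

Lemma ipZr n a (x y : 'cV[C]_n) : ip x (a *: y) = a * ip x y.
Proof. by rewrite !ipE mulr_sumr; apply: eq_bigr => i _; rewrite mxE mulrCA. Qed.

Lemma ipC n (x y : 'cV[C]_n) : (ip x y)^* = ip y x.
Proof.
by rewrite !ipE rmorph_sum; apply: eq_bigr => i _; rewrite rmorphM /= conjCK mulrC.
Qed.

Lemma ipDl n (x y z : 'cV[C]_n) : ip (x + y) z = ip x z + ip y z.
Proof. by rewrite -ipC ipDr rmorphD /= !ipC. Qed.

Lemma ipZl n a (x y : 'cV[C]_n) : ip (a *: x) y = a^* * ip x y.
Proof. by rewrite -ipC ipZr rmorphM /= !ipC. Qed.

Lemma ip0r n (x : 'cV[C]_n) : ip x 0 = 0.
Proof. by rewrite -[0](scale0r 0) ipZr mul0r. Qed.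

Lemma ip0l n (x : 'cV[C]_n) : ip 0 x = 0.
Proof. by rewrite -ipC ip0r rmorph0. Qed.

Lemma ipNr n (x y : 'cV[C]_n) : ip x (- y) = - ip x y.
Proof. by rewrite -scaleN1r ipZr mulN1r. Qed.

Lemma ipNl n (x y : 'cV[C]_n) : ip (- x) y = - ip x y.
Proof. by rewrite -ipC ipNr rmorphN /= ipC. Qed.

Lemma ipBr n (x y z : 'cV[C]_n) : ip x (y - z) = ip x y - ip x z.
Proof. by rewrite ipDr ipNr. Qed.

Lemma ipBl n (x y z : 'cV[C]_n) : ip (x - y) z = ip x z - ip y z.
Proof. by rewrite ipDl ipNl. Qed.

Lemma ip_sumr n I (r : seq I) (P : pred I) x (F : I -> 'cV[C]_n) :
  ip x (\sum_(i <- r | P i) F i) = \sum_(i <- r | P i) ip x (F i).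
Proof. by apply: (big_morph (ip x)) => [u v|]; rewrite ?ipDr ?ip0r. Qed.

Lemma ip_suml n I (r : seq I) (P : pred I) x (F : I -> 'cV[C]_n) :
  ip (\sum_(i <- r | P i) F i) x = \sum_(i <- r | P i) ip (F i) x.
Proof. by apply: (big_morph (fun y => ip y x)) => [u v|]; rewrite ?ipDl ?ip0l. Qed.

Lemma ip_ge0 n (x : 'cV[C]_n) : 0 <= ip x x.
Proof. by apply: sumr_ge0 => i _; rewrite mulrC mul_conjC_ge0. Qed.

Lemma ip_eq0 n (x : 'cV[C]_n) : ip x x = 0 -> x = 0.
Proof.
move/eqP; rewrite ipE psumr_eq0; last by move=> i _; rewrite mulrC mul_conjC_ge0.
move/allP => h; apply/colP => i; rewrite mxE; apply/eqP.
by rewrite -mul_conjC_eq0 mulrC; apply: h; rewrite mem_index_enum.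
Qed.

Lemma ip_ext n (x y : 'cV[C]_n) : (forall w, ip w x = ip w y) -> x = y.
Proof.
by move=> h; apply/eqP; rewrite -subr_eq0; apply/eqP/ip_eq0; rewrite ipBr h subrr.
Qed.

Lemma adj_opE n (A : 'M[C]_n) i j : adj_op A i j = (A j i)^*.
Proof. by rewrite !mxE. Qed.

Lemma ip_adj n (A : 'M[C]_n) x y : ip x (A *m y) = ip (adj_op A *m x) y.
Proof.
rewrite !ipE; under eq_bigr do rewrite mxE mulr_sumr.
rewrite exchange_big; apply: eq_bigr => i _; rewrite mxE rmorph_sum mulr_suml.
by apply: eq_bigr => j _; rewrite rmorphM /= adj_opE conjCK mulrA [_^* * _]mulrC.
Qed.

Lemma adj_opK n : involutive (@adj_op C n).
Proof. by move=> A; apply/matrixP => i j; rewrite !adj_opE conjCK. Qed.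

Lemma ip_adjl n (A : 'M[C]_n) x y : ip (A *m x) y = ip x (adj_op A *m y).
Proof. by rewrite ip_adj adj_opK. Qed.

Lemma adj_opM n (A B : 'M[C]_n) : adj_op (A *m B) = adj_op B *m adj_op A.
Proof. by rewrite /adj_op map_mxM trmx_mul. Qed.

Lemma adj_op1 n : adj_op 1%:M = 1%:M :> 'M[C]_n.
Proof. by rewrite /adj_op map_mx1 trmx1. Qed.

Lemma adj_opD n (A B : 'M[C]_n) : adj_op (A + B) = adj_op A + adj_op B.
Proof. by rewrite /adj_op map_mxD linearD. Qed.

Lemma adj_opZ n a (A : 'M[C]_n) : adj_op (a *: A) = a^* *: adj_op A.
Proof. by rewrite /adj_op map_mxZ linearZ. Qed.

Lemma adj_op_sum n I (r : seq I) (P : pred I) (F : I -> 'M[C]_n) :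
  adj_op (\sum_(i <- r | P i) F i) = \sum_(i <- r | P i) adj_op (F i).
Proof.
apply: (big_morph (@adj_op C n)) => [A B|]; first exact: adj_opD.
by rewrite /adj_op map_mx0 trmx0.
Qed.

Definition bas n (k : 'I_n) : 'cV[C]_n := delta_mx k 0.

Lemma ip_bas n (k : 'I_n) x : ip (bas k) x = x k 0.
Proof.
rewrite ipE (bigD1 k) //= big1 => [|i /negPf nik].
  by rewrite mxE !eqxx rmorph1 mul1r addr0.
by rewrite mxE nik rmorph0 mul0r.
Qed.

Lemma bas_exp n (x : 'cV[C]_n) : x = \sum_k ip (bas k) x *: bas k.
Proof.
rewrite {1}[x]matrix_sum_delta; apply: eq_bigr => k _.
by rewrite big_ord1 ip_bas.
Qed.

Lemma ip_bas_exp n (x y : 'cV[C]_n) : ip x y = \sum_k ip x (bas k) * ip (bas k) y.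
Proof. by rewrite {1}[y]bas_exp ip_sumr; apply: eq_bigr => k _; rewrite ipZr mulrC. Qed.

Lemma mx_ext m n (A B : 'M[C]_(m, n)) : (forall x : 'cV_n, A *m x = B *m x) -> A = B.
Proof.
move=> h; apply/matrixP => i j.
by have /colP/(_ i) := h (bas j); rewrite /bas -!colE !mxE.
Qed.

Lemma op_ext n (A B : 'M[C]_n) :
  (forall w x, ip w (A *m x) = ip w (B *m x)) -> A = B.
Proof. by move=> h; apply: mx_ext => x; apply: ip_ext => w. Qed.

Lemma mxtrace_bas n (A : 'M[C]_n) : \tr A = \sum_k ip (bas k) (A *m bas k).
Proof. by apply: eq_bigr => k _; rewrite ip_bas /bas -colE mxE. Qed.

Lemma adj_comm n (A B : 'M[C]_n) :
  comm_mx A B -> comm_mx (adj_op A) (adj_op B).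
Proof. by rewrite /comm_mx -!adj_opM => ->. Qed.

End InnerProduct.

Section Tensor.
Variables (C : numClosedFieldType) (n : nat).
Implicit Types (x y u v w : 'cV[C]_n) (A B : 'M[C]_n) (V : 'M[C]_(n * n)).

Local Notation "x *v y" := (tens x y) (at level 40, left associativity).

Lemma tensE x y i j k : (x *v y) (mxtens_index (i, j)) k = x i 0 * y j 0.
Proof. by rewrite /tens !mxE mxtens_indexK /= !ord1. Qed.

Lemma big_mxtens (m p : nat) (F : 'I_(m * p) -> C) :
  \sum_i F i = \sum_i \sum_j F (mxtens_index (i, j)).
Proof.
rewrite pair_big (reindex (@mxtens_index m p)).
  by apply: eq_bigr => -[i j].
by exists (@mxtens_unindex m p) => k _; rewrite ?mxtens_indexK ?mxtens_unindexK.
Qed.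

Lemma ip_tens u v x y : ip (u *v v) (x *v y) = ip u x * ip v y.
Proof.
rewrite !ipE big_mxtens mulr_suml; apply: eq_bigr => i _.
rewrite mulr_sumr; apply: eq_bigr => j _.
by rewrite !tensE rmorphM mulrACA.
Qed.

Lemma tensDl x y z : (x + y) *v z = x *v z + y *v z.
Proof. by apply/colP => k; case: (mxtens_indexP k) => i j; rewrite [RHS]mxE !tensE mxE mulrDl. Qed.
Lemma tensDr x y z : z *v (x + y) = z *v x + z *v y.
Proof. by apply/colP => k; case: (mxtens_indexP k) => i j; rewrite [RHS]mxE !tensE mxE mulrDr. Qed.
Lemma tensZl a x y : (a *: x) *v y = a *: (x *v y).
Proof. by apply/colP => k; case: (mxtens_indexP k) => i j; rewrite [RHS]mxE !tensE mxE mulrA. Qed.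
Lemma tensZr a x y : x *v (a *: y) = a *: (x *v y).
Proof. by apply/colP => k; case: (mxtens_indexP k) => i j; rewrite [RHS]mxE !tensE mxE mulrCA. Qed.
Lemma tens0l y : 0 *v y = 0.
Proof. by rewrite -(scale0r 0) tensZl scale0r. Qed.
Lemma tens0r y : y *v 0 = 0.
Proof. by rewrite -(scale0r 0) tensZr scale0r. Qed.

Lemma tens_suml I (r : seq I) (P : pred I) (F : I -> 'cV[C]_n) y :
  (\sum_(i <- r | P i) F i) *v y = \sum_(i <- r | P i) F i *v y.
Proof. by apply: (big_morph (fun x => x *v y)) => [u v|]; rewrite ?tensDl ?tens0l. Qed.
Lemma tens_sumr I (r : seq I) (P : pred I) (F : I -> 'cV[C]_n) y :
  y *v (\sum_(i <- r | P i) F i) = \sum_(i <- r | P i) y *v F i.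
Proof. by apply: (big_morph (fun x => y *v x)) => [u v|]; rewrite ?tensDr ?tens0r. Qed.

Lemma bas_tens (i j : 'I_n) : bas C (idx2 i j) = bas C i *v bas C j.
Proof.
apply/colP => k; case: (mxtens_indexP k) => a b; rewrite tensE !mxE !eqxx !andbT.
rewrite (can_eq (@mxtens_indexK n n)) xpair_eqE.
by case: (a == i); case: (b == j); rewrite ?mulr1 ?mul1r ?mul0r ?mulr0.
Qed.

Lemma ip2_ext (z t : 'cV[C]_(n * n)) :
  (forall u v, ip (u *v v) z = ip (u *v v) t) -> z = t.
Proof.
move=> h; apply/colP => k; case: (mxtens_indexP k) => i j.
by rewrite -!ip_bas -/(idx2 i j) bas_tens h.
Qed.

Lemma op2_ext (A B : 'M[C]_(n * n)) :
  (forall x y, A *m (x *v y) = B *m (x *v y)) -> A = B.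
Proof.
move=> h; apply/matrixP => p q; case: (mxtens_indexP q) => i j.
have /colP/(_ p) := h (bas C i) (bas C j).
by rewrite -bas_tens /bas -!colE !mxE.
Qed.

Lemma op2_ip_ext (A B : 'M[C]_(n * n)) :
  (forall u v x y, ip (u *v v) (A *m (x *v y)) = ip (u *v v) (B *m (x *v y))) -> A = B.
Proof. by move=> h; apply: op2_ext => x y; apply: ip2_ext => u v. Qed.

Definition op1 A : 'M[C]_(n * n) := A *t 1%:M.
Definition op2 A : 'M[C]_(n * n) := 1%:M *t A.

Lemma op1E A x y : op1 A *m (x *v y) = (A *m x) *v y.
Proof. by have := tensmx_mul A 1%:M x y; rewrite mul1mx. Qed.
Lemma op2E A x y : op2 A *m (x *v y) = x *v (A *m y).
Proof. by have := tensmx_mul 1%:M A x y; rewrite mul1mx. Qed.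
Lemma op1M A B : op1 (A *m B) = op1 A *m op1 B.
Proof. by rewrite /op1 tensmx_mul mul1mx. Qed.
Lemma op2M A B : op2 (A *m B) = op2 A *m op2 B.
Proof. by rewrite /op2 tensmx_mul mul1mx. Qed.
Lemma op1_1 : op1 1%:M = 1%:M.
Proof. by apply: op2_ext => x y; rewrite op1E !mul1mx. Qed.
Lemma op2_1 : op2 1%:M = 1%:M.
Proof. by apply: op2_ext => x y; rewrite op2E !mul1mx. Qed.
Lemma op12 A B : comm_mx (op1 A) (op2 B).
Proof. by rewrite /comm_mx /op1 /op2 !tensmx_mul !mul1mx !mulmx1. Qed.

Lemma adj_op2_ext (A B : 'M[C]_(n * n)) :
  (forall u v x y, ip (u *v v) (A *m (x *v y)) = ip (B *m (u *v v)) (x *v y)) ->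
  adj_op A = B.
Proof.
move=> h; apply: op2_ip_ext => u v x y.
by rewrite -ip_adjl -ipC -[RHS]ipC h.
Qed.

Lemma adj_op1E A : adj_op (op1 A) = op1 (adj_op A).
Proof. by apply: adj_op2_ext => u v x y; rewrite !op1E !ip_tens ip_adj. Qed.
Lemma adj_op2E A : adj_op (op2 A) = op2 (adj_op A).
Proof. by apply: adj_op2_ext => u v x y; rewrite !op2E !ip_tens ip_adj. Qed.

Definition swap : 'M[C]_(n * n) :=
  \matrix_(p, q) ((mxtens_unindex p == ((mxtens_unindex q).2, (mxtens_unindex q).1))%:R).

Lemma swapE x y : swap *m (x *v y) = y *v x.
Proof.
apply/colP => k; case: (mxtens_indexP k) => i j; rewrite tensE mxE.
rewrite big_mxtens (bigD1 j) //= (bigD1 i) //= !big1 ?addr0.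
- by rewrite mxE !mxtens_indexK eqxx mul1r tensE mulrC.
- move=> l /negPf nl; rewrite big1 // => m _.
  by rewrite mxE !mxtens_indexK xpair_eqE [j == l]eq_sym nl andbF mul0r.
- by move=> l /negPf nl; rewrite mxE !mxtens_indexK xpair_eqE [i == l]eq_sym nl mul0r.
Qed.

Lemma swapK : swap *m swap = 1%:M.
Proof. by apply: op2_ext => x y; rewrite -mulmxA !swapE mul1mx. Qed.
Lemma adj_swap : adj_op swap = swap.
Proof. by apply: adj_op2_ext => u v x y; rewrite !swapE !ip_tens mulrC. Qed.
Lemma swap1 A : swap *m op1 A = op2 A *m swap.
Proof. by apply: op2_ext => x y; rewrite -!mulmxA op1E !swapE op2E. Qed.
Lemma swap2 A : swap *m op2 A = op1 A *m swap.
Proof. by apply: op2_ext => x y; rewrite -!mulmxA op2E !swapE op1E. Qed.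

(* The slices (u^* (x) 1) V (v (x) 1) and (1 (x) u^* ) V (1 (x) v). *)
Definition Lsl V u v : 'M[C]_n :=
  \matrix_(k, l) ip (u *v bas C k) (V *m (v *v bas C l)).
Definition Rsl V u v : 'M[C]_n :=
  \matrix_(k, l) ip (bas C k *v u) (V *m (bas C l *v v)).

Lemma ip_mx A w x : ip w (A *m x) = \sum_k \sum_l (w k 0)^* * A k l * x l 0.
Proof.
rewrite ipE; apply: eq_bigr => k _; rewrite mxE mulr_sumr.
by apply: eq_bigr => l _; rewrite mulrA.
Qed.

Lemma ip_delta a b u v : ip u (delta_mx a b *m v) = (u a 0)^* * v b 0.
Proof.
rewrite ip_mx (bigD1 a) //= (bigD1 b) //= !big1 ?addr0 => [|i /negPf ni|i /negPf ni].
- by rewrite mxE !eqxx mulr1.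
- by rewrite big1 // => j _; rewrite mxE ni mulr0 mul0r.
- by rewrite mxE eqxx ni mulr0 mul0r.
Qed.

Lemma LE V u v w x : ip w (Lsl V u v *m x) = ip (u *v w) (V *m (v *v x)).
Proof.
rewrite ip_mx [w in RHS]bas_exp [x in RHS]bas_exp tens_sumr ip_suml.
apply: eq_bigr => k _; rewrite tens_sumr mulmx_sumr ip_sumr; apply: eq_bigr => l _.
by rewrite mxE !tensZr -scalemxAr ipZl ipZr !ip_bas mulrCA mulrC.
Qed.

Lemma RE V u v w x : ip w (Rsl V u v *m x) = ip (w *v u) (V *m (x *v v)).
Proof.
rewrite ip_mx [w in RHS]bas_exp [x in RHS]bas_exp tens_suml ip_suml.
apply: eq_bigr => k _; rewrite tens_suml mulmx_sumr ip_sumr; apply: eq_bigr => l _.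
by rewrite mxE !tensZl -scalemxAr ipZl ipZr !ip_bas mulrCA mulrC.
Qed.

Lemma RL V u v w x : ip w (Rsl V u v *m x) = ip u (Lsl V w x *m v).
Proof. by rewrite RE LE. Qed.

Lemma expL V v x : V *m (v *v x) = \sum_k bas C k *v (Lsl V (bas C k) v *m x).
Proof.
apply: ip2_ext => u w; rewrite ip_sumr -LE.
rewrite {1}(_ : Lsl V u v *m x = \sum_k ip u (bas C k) *: (Lsl V (bas C k) v *m x)).
  by rewrite ip_sumr; apply: eq_bigr => k _; rewrite ipZr ip_tens.
apply: ip_ext => z; rewrite LE ip_sumr {1}[u]bas_exp tens_suml ip_suml.
by apply: eq_bigr => k _; rewrite tensZl ipZl ipZr LE ipC.
Qed.

Lemma expR V v x : V *m (x *v v) = \sum_k (Rsl V (bas C k) v *m x) *v bas C k.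
Proof.
apply: ip2_ext => w u; rewrite ip_sumr -RE.
rewrite {1}(_ : Rsl V u v *m x = \sum_k ip u (bas C k) *: (Rsl V (bas C k) v *m x)).
  by rewrite ip_sumr; apply: eq_bigr => k _; rewrite ipZr ip_tens mulrC.
apply: ip_ext => z; rewrite RE ip_sumr {1}[u]bas_exp tens_sumr ip_suml.
by apply: eq_bigr => k _; rewrite tensZr ipZl ipZr RE ipC.
Qed.

Lemma op_extL V V' : (forall u v, Lsl V u v = Lsl V' u v) -> V = V'.
Proof. by move=> h; apply: op2_ip_ext => u v x y; rewrite -!LE h. Qed.

Lemma Lsl_adj V u v : Lsl (adj_op V) u v = adj_op (Lsl V v u).
Proof. by apply: op_ext => w x; rewrite LE -!ip_adjl -ipC -LE ipC. Qed.
Lemma Rsl_adj V u v : Rsl (adj_op V) u v = adj_op (Rsl V v u).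
Proof. by apply: op_ext => w x; rewrite RE -!ip_adjl -ipC -RE ipC. Qed.

Lemma Lsl_op2 V A u v : Lsl (V *m op2 A) u v = Lsl V u v *m A.
Proof. by apply: op_ext => w x; rewrite -mulmxA !LE -mulmxA op2E. Qed.
Lemma op2_Lsl V A u v : Lsl (op2 A *m V) u v = A *m Lsl V u v.
Proof. by apply: op_ext => w x; rewrite -mulmxA LE [RHS]ip_adj LE -mulmxA ip_adj adj_op2E op2E. Qed.
Lemma Lsl_op1 V A u v : Lsl (V *m op1 A) u v = Lsl V u (A *m v).
Proof. by apply: op_ext => w x; rewrite !LE -mulmxA op1E. Qed.
Lemma op1_Lsl V A u v : Lsl (op1 A *m V) u v = Lsl V (adj_op A *m u) v.
Proof. by apply: op_ext => w x; rewrite !LE -mulmxA ip_adj adj_op1E op1E. Qed.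
Lemma Rsl_op1 V A u v : Rsl (V *m op1 A) u v = Rsl V u v *m A.
Proof. by apply: op_ext => w x; rewrite -mulmxA !RE -mulmxA op1E. Qed.
Lemma op1_Rsl V A u v : Rsl (op1 A *m V) u v = A *m Rsl V u v.
Proof. by apply: op_ext => w x; rewrite -mulmxA RE [RHS]ip_adj RE -mulmxA ip_adj adj_op1E op1E. Qed.
Lemma Rsl_op2 V A u v : Rsl (V *m op2 A) u v = Rsl V u (A *m v).
Proof. by apply: op_ext => w x; rewrite !RE -mulmxA op2E. Qed.
Lemma op2_Rsl V A u v : Rsl (op2 A *m V) u v = Rsl V (adj_op A *m u) v.
Proof. by apply: op_ext => w x; rewrite !RE -mulmxA ip_adj adj_op2E op2E. Qed.

Lemma Rsl_ext V V' : (forall u v, Rsl V u v = Rsl V' u v) -> V = V'.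
Proof. by move=> h; apply: op2_ip_ext => u v x y; rewrite -!RE h. Qed.

Lemma comm_op2P V A : comm_mx V (op2 A) <-> forall u v, comm_mx (Lsl V u v) A.
Proof.
split=> [h u v|h]; first by rewrite /comm_mx -Lsl_op2 h op2_Lsl.
by apply: op_extL => u v; rewrite Lsl_op2 h op2_Lsl.
Qed.

Lemma comm_op1P V A : comm_mx V (op1 A) <-> forall u v, comm_mx (Rsl V u v) A.
Proof.
split=> [h u v|h]; first by rewrite /comm_mx -Rsl_op1 h op1_Rsl.
by apply: Rsl_ext => u v; rewrite Rsl_op1 h op1_Rsl.
Qed.

Lemma LslM V V' u v : Lsl (V *m V') u v = \sum_k Lsl V u (bas C k) *m Lsl V' (bas C k) v.
Proof.
apply: op_ext => w x; rewrite mulmx_suml ip_sumr LE -mulmxA expL mulmx_sumr ip_sumr.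
by apply: eq_bigr => k _; rewrite -mulmxA LE.
Qed.
Lemma RslM V V' u v : Rsl (V *m V') u v = \sum_k Rsl V u (bas C k) *m Rsl V' (bas C k) v.
Proof.
apply: op_ext => w x; rewrite mulmx_suml ip_sumr RE -mulmxA expR mulmx_sumr ip_sumr.
by apply: eq_bigr => k _; rewrite -mulmxA RE.
Qed.

Lemma Lsl_dual V u v : Lsl (swap *m V *m swap) u v = Rsl V u v.
Proof.
apply: op_ext => w x; rewrite LE RE -mulmxA -mulmxA swapE.
by rewrite ip_adj adj_swap swapE.
Qed.
Lemma Rsl_dual V u v : Rsl (swap *m V *m swap) u v = Lsl V u v.
Proof.
apply: op_ext => w x; rewrite LE RE -mulmxA -mulmxA swapE.
by rewrite ip_adj adj_swap swapE.
Qed.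

Lemma tr_L V u v : \tr (Lsl V u v) = \sum_k ip u (Rsl V (bas C k) (bas C k) *m v).
Proof. by rewrite mxtrace_bas; apply: eq_bigr => k _; rewrite RL. Qed.

Lemma mxtrace2 (M : 'M[C]_(n * n)) :
  \tr M = \sum_i \sum_j ip (bas C i *v bas C j) (M *m (bas C i *v bas C j)).
Proof.
rewrite mxtrace_bas big_mxtens; apply: eq_bigr => i _; apply: eq_bigr => j _.
by rewrite -/(idx2 i j) bas_tens.
Qed.

End Tensor.

(** * Slices and the pentagon equation *)

Section Pentagon.
Variables (C : numClosedFieldType) (n : nat).
Implicit Types (u v w : 'cV[C]_n) (A B : 'M[C]_n) (V : 'M[C]_(n * n)).
Local Notation "x *v y" := (tens x y) (at level 40, left associativity).

Lemma sum_deltal (a : 'I_n) (F : 'I_n -> C) : \sum_i (a == i)%:R * F i = F a.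
Proof.
rewrite (bigD1 a) //= eqxx mul1r big1 ?addr0 // => i /negPf nia.
by rewrite eq_sym nia mul0r.
Qed.

Lemma sum_deltar (a : 'I_n) (F : 'I_n -> C) : \sum_i F i * (i == a)%:R = F a.
Proof.
by rewrite -[RHS](sum_deltal a); apply: eq_bigr => i _; rewrite mulrC eq_sym.
Qed.

Definition pent_scalar V := forall p1 p2 p3 q1 q2 q3 : 'I_n,
  \sum_k \sum_l \sum_m V (idx2 p1 p2) (idx2 k l) * V (idx2 k p3) (idx2 q1 m)
     * V (idx2 l m) (idx2 q2 q3) =
  \sum_m V (idx2 p2 p3) (idx2 m q3) * V (idx2 p1 m) (idx2 q1 q2).

Definition idx3 (a b c : 'I_n) : 'I_(n * n * n) := mxtens_index (idx2 a b, c).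

Lemma i1E a b c : i1 (idx3 a b c) = a.
Proof. by rewrite /i1 /idx3 /idx2 !mxtens_indexK. Qed.
Lemma i2E a b c : i2 (idx3 a b c) = b.
Proof. by rewrite /i2 /idx3 /idx2 !mxtens_indexK. Qed.
Lemma i3E a b c : i3 (idx3 a b c) = c.
Proof. by rewrite /i3 /idx3 /idx2 !mxtens_indexK. Qed.
Definition iE := (i1E, i2E, i3E).

Lemma big_idx3 (F : 'I_(n * n * n) -> C) :
  \sum_r F r = \sum_a \sum_b \sum_c F (idx3 a b c).
Proof. by rewrite big_mxtens big_mxtens. Qed.

Lemma idx3P (P : 'I_(n * n * n) -> Prop) :
  (forall a b c, P (idx3 a b c)) -> forall p, P p.
Proof.
by move=> h p; case: (mxtens_indexP p) => q c; case: (mxtens_indexP q) => a b; apply: h.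
Qed.

Lemma pent_legs V :
  leg12 V *m leg13 V *m leg23 V = leg23 V *m leg12 V <-> pent_scalar V.
Proof.
have lhs p1 p2 p3 q1 q2 q3 :
    (leg12 V *m leg13 V *m leg23 V) (idx3 p1 p2 p3) (idx3 q1 q2 q3) =
    \sum_k \sum_l \sum_m V (idx2 p1 p2) (idx2 k l) * V (idx2 k p3) (idx2 q1 m)
       * V (idx2 l m) (idx2 q2 q3).
  rewrite -mulmxA mxE big_idx3; apply: eq_bigr => k _; apply: eq_bigr => l _.
  under eq_bigr do rewrite mxE !iE -mulrA mulrCA.
  rewrite sum_deltal mxE big_idx3 mulr_sumr.
  under eq_bigr => a _.
    rewrite exchange_big mulr_sumr /=.
    under eq_bigr => m _.
      under eq_bigr do rewrite [leg13 _ _ _]mxE [leg23 _ _ _]mxE !iE -!mulrA.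
      rewrite sum_deltal mulrCA.
      over.
    over.
  rewrite exchange_big; apply: eq_bigr => m _ /=.
  under eq_bigr do rewrite [(_ == _)%:R * _]mulrC !mulrA.
  by rewrite sum_deltar [V (idx2 k p3) _ * _]mulrC.
have rhs p1 p2 p3 q1 q2 q3 :
    (leg23 V *m leg12 V) (idx3 p1 p2 p3) (idx3 q1 q2 q3) =
    \sum_m V (idx2 p2 p3) (idx2 m q3) * V (idx2 p1 m) (idx2 q1 q2).
  rewrite mxE big_idx3 exchange_big; apply: eq_bigr => m _ /=.
  under eq_bigr => a _.
    under eq_bigr do rewrite [leg23 _ _ _]mxE [leg12 _ _ _]mxE !iE mulrA.
    rewrite sum_deltar -mulrA; over.
  by rewrite sum_deltal.
split=> [h p1 p2 p3 q1 q2 q3|h]; first by rewrite -lhs -rhs h.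
apply/matrixP; apply: idx3P => p1 p2 p3; apply: idx3P => q1 q2 q3.
by rewrite lhs rhs h.
Qed.

Lemma op1D A B : op1 (A + B) = op1 A + op1 B.
Proof. by apply: op2_ext => x y; rewrite mulmxDl !op1E mulmxDl tensDl. Qed.
Lemma op2D A B : op2 (A + B) = op2 A + op2 B.
Proof. by apply: op2_ext => x y; rewrite mulmxDl !op2E mulmxDl tensDr. Qed.
Lemma op1Z a A : op1 (a *: A) = a *: op1 A.
Proof. by apply: op2_ext => x y; rewrite -scalemxAl !op1E -scalemxAl tensZl. Qed.
Lemma op2Z a A : op2 (a *: A) = a *: op2 A.
Proof. by apply: op2_ext => x y; rewrite -scalemxAl !op2E -scalemxAl tensZr. Qed.
Lemma op1_sum I (r : seq I) (P : pred I) (F : I -> 'M[C]_n) :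
  op1 (\sum_(i <- r | P i) F i) = \sum_(i <- r | P i) op1 (F i).
Proof. by apply: (big_morph (@op1 C n)) => [A B|]; [exact: op1D | exact: tens0mx]. Qed.
Lemma op2_sum I (r : seq I) (P : pred I) (F : I -> 'M[C]_n) :
  op2 (\sum_(i <- r | P i) F i) = \sum_(i <- r | P i) op2 (F i).
Proof. by apply: (big_morph (@op2 C n)) => [A B|]; [exact: op2D | exact: tensmx0]. Qed.

Lemma Lsl_suml V u v : Lsl V u v = \sum_a (u a 0)^* *: Lsl V (bas C a) v.
Proof.
apply: op_ext => w x; rewrite mulmx_suml ip_sumr LE {1}[u]bas_exp tens_suml ip_suml.
by apply: eq_bigr => a _; rewrite tensZl ipZl -scalemxAl ipZr LE ip_bas.
Qed.
Lemma Lsl_sumr V u v : Lsl V u v = \sum_b v b 0 *: Lsl V u (bas C b).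
Proof.
apply: op_ext => w x; rewrite mulmx_suml ip_sumr LE {1}[v]bas_exp tens_suml.
rewrite mulmx_sumr ip_sumr; apply: eq_bigr => a _.
by rewrite tensZl -scalemxAr ipZr -scalemxAl ipZr LE ip_bas.
Qed.
Lemma Rsl_suml V u v : Rsl V u v = \sum_a (u a 0)^* *: Rsl V (bas C a) v.
Proof. by rewrite -Lsl_dual Lsl_suml; apply: eq_bigr => a _; rewrite Lsl_dual. Qed.
Lemma Rsl_sumr V u v : Rsl V u v = \sum_b v b 0 *: Rsl V u (bas C b).
Proof. by rewrite -Lsl_dual Lsl_sumr; apply: eq_bigr => a _; rewrite Lsl_dual. Qed.

Lemma mx_bas m (A : 'M[C]_m) i j : A i j = ip (bas C i) (A *m bas C j).
Proof. by rewrite ip_bas /bas -colE mxE. Qed.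
Lemma Lsl_bas V i j a b : Lsl V (bas C a) (bas C b) i j = V (idx2 a i) (idx2 b j).
Proof. by rewrite mxE -!bas_tens -mx_bas. Qed.
Lemma Rsl_bas V i j a b : Rsl V (bas C a) (bas C b) i j = V (idx2 i a) (idx2 j b).
Proof. by rewrite mxE -!bas_tens -mx_bas. Qed.

(** The pentagon equation sliced in its first leg: for unitary [V], conjugating x (x) 1 by [V] is
    the coproduct of S. [pentR] is the slice in the third leg, which gives the coproduct of the
    dual. *)
Definition pentL V := forall u v,
  V *m op1 (Lsl V u v) =
  (\sum_k op1 (Lsl V u (bas C k)) *m op2 (Lsl V (bas C k) v)) *m V.
Definition pentR V := forall u v,
  op2 (Rsl V u v) *m V =
  V *m (\sum_k op1 (Rsl V u (bas C k)) *m op2 (Rsl V (bas C k) v)).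

Lemma tens12 A B : op1 A *m op2 B = A *t B.
Proof. by rewrite /op1 /op2 tensmx_mul mulmx1 mul1mx. Qed.

Lemma pentL_basP V : pent_scalar V <-> forall a b : 'I_n,
  V *m op1 (Lsl V (bas C a) (bas C b)) =
  (\sum_k op1 (Lsl V (bas C a) (bas C k)) *m op2 (Lsl V (bas C k) (bas C b))) *m V.
Proof.
have lhs (a b p2 p3 q2 q3 : 'I_n) :
   (V *m op1 (Lsl V (bas C a) (bas C b))) (idx2 p2 p3) (idx2 q2 q3) =
   \sum_m V (idx2 p2 p3) (idx2 m q3) * V (idx2 a m) (idx2 b q2).
  rewrite mxE big_mxtens; apply: eq_bigr => m _.
  under eq_bigr do rewrite tensmxE Lsl_bas mxE mulrA.
  by rewrite sum_deltar.
have rhs (a b p2 p3 q2 q3 : 'I_n) :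
   ((\sum_k op1 (Lsl V (bas C a) (bas C k)) *m op2 (Lsl V (bas C k) (bas C b))) *m V)
      (idx2 p2 p3) (idx2 q2 q3) =
   \sum_k \sum_l \sum_m V (idx2 a p2) (idx2 k l) * V (idx2 k p3) (idx2 b m)
       * V (idx2 l m) (idx2 q2 q3).
  rewrite mulmx_suml summxE; apply: eq_bigr => k _.
  rewrite mxE big_mxtens; apply: eq_bigr => l _; apply: eq_bigr => m _.
  by rewrite tens12 tensmxE !Lsl_bas.
split=> [h a b|h p1 p2 p3 q1 q2 q3]; last by rewrite -lhs h rhs.
apply/matrixP => p q; case: (mxtens_indexP p) => p2 p3; case: (mxtens_indexP q) => q2 q3.
by rewrite -/(idx2 p2 p3) -/(idx2 q2 q3) lhs rhs h.
Qed.

Lemma pentL_of V : pent_scalar V -> pentL V.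
Proof.
move/pentL_basP => h u v.
rewrite Lsl_suml op1_sum mulmx_sumr mulmx_suml.
under [RHS]eq_bigr do rewrite (Lsl_suml _ u) op1_sum !mulmx_suml.
rewrite exchange_big; apply: eq_bigr => a _ /=.
rewrite Lsl_sumr scaler_sumr op1_sum mulmx_sumr.
under [RHS]eq_bigr do rewrite (Lsl_sumr _ _ v) op2_sum mulmx_sumr mulmx_suml.
rewrite exchange_big; apply: eq_bigr => b _ /=.
rewrite !op1Z -!scalemxAr h mulmx_suml !scaler_sumr; apply: eq_bigr => k _.
by rewrite op1Z op2Z -!(scalemxAl, scalemxAr).
Qed.

Lemma pentR_of V : pent_scalar V -> pentR V.
Proof.
move=> h0.
have h (a b : 'I_n) : op2 (Rsl V (bas C a) (bas C b)) *m V =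
  V *m (\sum_k op1 (Rsl V (bas C a) (bas C k)) *m op2 (Rsl V (bas C k) (bas C b))).
  apply/matrixP => p q; case: (mxtens_indexP p) => p1 p2; case: (mxtens_indexP q) => q1 q2.
  rewrite mxE big_mxtens exchange_big.
  under eq_bigr => m _.
    under eq_bigr do rewrite tensmxE mxE Rsl_bas -mulrA.
    rewrite sum_deltal; over.
  rewrite -/(idx2 p1 p2) -/(idx2 q1 q2) -h0 mxE big_mxtens.
  apply: eq_bigr => k _; apply: eq_bigr => l _; rewrite summxE mulr_sumr.
  by apply: eq_bigr => m _; rewrite tens12 tensmxE !Rsl_bas mulrA.
move=> u v.
rewrite Rsl_suml op2_sum mulmx_suml mulmx_sumr.
under [RHS]eq_bigr do rewrite (Rsl_suml _ u) op1_sum mulmx_suml mulmx_sumr.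
rewrite exchange_big; apply: eq_bigr => a _ /=.
rewrite Rsl_sumr scaler_sumr op2_sum mulmx_suml.
under [RHS]eq_bigr do rewrite (Rsl_sumr _ _ v) op2_sum !mulmx_sumr.
rewrite exchange_big; apply: eq_bigr => b _ /=.
rewrite !op2Z -!scalemxAl h mulmx_sumr !scaler_sumr; apply: eq_bigr => k _.
by rewrite op1Z op2Z -!(scalemxAl, scalemxAr).
Qed.

Record munit V : Prop := MUnit {
  mu_l : adj_op V *m V = 1%:M;
  mu_r : V *m adj_op V = 1%:M;
  mu_pL : pentL V;
  mu_pR : pentR V }.

Lemma munitP V : multiplicative_unitary V -> munit V.
Proof.
by case=> -[h1 h2] /pent_legs h; split=> //; [exact: pentL_of | exact: pentR_of].
Qed.

Lemma munit_inv V : adj_op V *m V = 1%:M -> V *m adj_op V = 1%:M -> pentL V ->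
  multiplicative_unitary V.
Proof. by move=> h1 h2 h; split=> //; apply/pent_legs/pentL_basP => a b; apply: h. Qed.

(* This exchanges S and its dual, and fixed and cofixed vectors, so that a statement on [V] has a dual one. *)
Definition dualV V : 'M[C]_(n * n) := swap C n *m adj_op V *m swap C n.

Lemma dualVE V x y : dualV V *m (x *v y) = swap C n *m (adj_op V *m (y *v x)).
Proof. by rewrite /dualV -!mulmxA swapE. Qed.

Lemma adj_dualV V : adj_op (dualV V) = swap C n *m V *m swap C n.
Proof. by rewrite /dualV !adj_opM adj_opK adj_swap mulmxA. Qed.

Lemma adj_dualVE V x y : adj_op (dualV V) *m (x *v y) = swap C n *m (V *m (y *v x)).
Proof. by rewrite adj_dualV -!mulmxA swapE. Qed.

Lemma dualVK : involutive dualV.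
Proof.
move=> V; rewrite {1}/dualV adj_dualV !mulmxA swapK mul1mx -mulmxA swapK.
by rewrite mulmx1.
Qed.

Lemma L_dualV V u v : Lsl (dualV V) u v = adj_op (Rsl V v u).
Proof. by rewrite Lsl_dual Rsl_adj. Qed.
Lemma R_dualV V u v : Rsl (dualV V) u v = adj_op (Lsl V v u).
Proof. by rewrite Rsl_dual Lsl_adj. Qed.

Lemma dualV_munit V : munit V -> munit (dualV V).
Proof.
case=> h1 h2 pL pR; split.
- rewrite adj_dualV /dualV !mulmxA -[_ *m swap C n *m swap C n]mulmxA swapK mulmx1.
  by rewrite -[_ *m V *m _]mulmxA h2 mulmx1 swapK.
- rewrite adj_dualV /dualV !mulmxA -[_ *m swap C n *m swap C n]mulmxA swapK mulmx1.
  by rewrite -[_ *m adj_op V *m _]mulmxA h1 mulmx1 swapK.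
- move=> u v; have /(congr1 (@adj_op C _)) := pR v u.
  rewrite !adj_opM adj_op2E adj_op_sum => h.
  rewrite L_dualV /dualV -!mulmxA swap1 [adj_op V *m _]mulmxA h.
  rewrite !mulmxA; congr (_ *m _ *m _).
  rewrite mulmx_suml mulmx_sumr; apply: eq_bigr => k _.
  rewrite -/(dualV V) !L_dualV adj_opM adj_op1E adj_op2E.
  by rewrite mulmxA swap2 -!mulmxA swap1.
- move=> u v; have /(congr1 (@adj_op C _)) := pL v u.
  rewrite !adj_opM adj_op1E adj_op_sum => h.
  rewrite R_dualV /dualV 2!mulmxA -swap1 -[swap C n *m _ *m _]mulmxA h.
  rewrite -!mulmxA; congr (_ *m (_ *m _)).
  rewrite mulmx_suml mulmx_sumr; apply: eq_bigr => k _.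
  rewrite [swap C n *m (adj_op V *m _)]mulmxA -/(dualV V) !R_dualV adj_opM adj_op1E adj_op2E.
  by rewrite mulmxA swap1 -!mulmxA swap2 !mulmxA.
Qed.

End Pentagon.

(** * Cyclicity of the fixed vector *)

Section Slices.
Variables (C : numClosedFieldType) (n : nat).
Implicit Types (u v w z : 'cV[C]_n) (A B : 'M[C]_n) (V : 'M[C]_(n * n)).
Local Notation "x *v y" := (tens x y) (at level 40, left associativity).
Local Notation bas := (@bas C n).

Lemma norm_eq m (x y : 'cV[C]_m) : ip y y = ip x x -> ip x y = ip x x -> y = x.
Proof.
move=> h1 h2; apply/eqP; rewrite -subr_eq0; apply/eqP/ip_eq0.
by rewrite ipBr !ipBl h1 h2 -[ip y x]ipC h2 ipC !subrr.
Qed.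

Lemma ip_unit m (A : 'M[C]_m) x y : adj_op A *m A = 1%:M -> ip (A *m x) (A *m y) = ip x y.
Proof. by move=> h; rewrite ip_adj mulmxA h mul1mx. Qed.

Lemma adj_fix m (A : 'M[C]_m) (x : 'cV_m) : adj_op A *m A = 1%:M -> A *m x = x -> adj_op A *m x = x.
Proof. by move=> h {1}<-; rewrite mulmxA h mul1mx. Qed.

Section MU.
Variable V : 'M[C]_(n * n).
Hypothesis HV : munit V.

(** By [pentR], a product of two slices is read off from [V] acting on two legs only, so threefold
    tensor products no longer appear. *)
Lemma slice_mulL u u' v v' w w' :
  ip (V *m (u *v u')) (op2 (Rsl V w w') *m (V *m (v *v v'))) =
  ip w (Lsl V u v *m (Lsl V u' v' *m w')).
Proof.
rewrite [op2 _ *m _]mulmxA (mu_pR HV) -mulmxA (ip_unit _ _ (mu_l HV)) mulmx_suml ip_sumr.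
rewrite ip_adj ip_bas_exp; apply: eq_bigr => k _.
by rewrite -mulmxA op2E op1E ip_tens !RL -ip_adj.
Qed.

Lemma slice_mulR u v w w' z z' :
  ip (adj_op V *m (w *v w')) (op1 (Lsl V u v) *m (adj_op V *m (z *v z'))) =
  ip u (Rsl V w z *m (Rsl V w' z' *m v)).
Proof.
rewrite -ip_adj !mulmxA (mu_pL HV) -[_ *m V *m _]mulmxA (mu_r HV) mulmx1.
rewrite mulmx_suml ip_sumr -mulmxA ip_adj ip_bas_exp; apply: eq_bigr => k _.
by rewrite -mulmxA op2E op1E ip_tens -ip_adj !RL.
Qed.

Lemma fixed_Rsl e u v : fixedv V e -> Rsl V u v *m e = ip u v *: e.
Proof. by move=> h; apply: ip_ext => w; rewrite RE h ip_tens ipZr mulrC. Qed.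
Lemma cofixed_Lsl e u v : cofixedv V e -> Lsl V u v *m e = ip u v *: e.
Proof. by move=> h; apply: ip_ext => w; rewrite LE h ip_tens ipZr. Qed.
Lemma fixed_adj e : fixedv V e -> fixedv (adj_op V) e.
Proof. by move=> h x; apply: adj_fix (mu_l HV) (h x). Qed.
Lemma cofixed_adj e : cofixedv V e -> cofixedv (adj_op V) e.
Proof. by move=> h x; apply: adj_fix (mu_l HV) (h x). Qed.

Lemma fixed_Lslr e u : fixedv V e -> Lsl V u e = (ip u e)%:M.
Proof. by move=> h; apply: op_ext => w x; rewrite LE h ip_tens mul_scalar_mx ipZr. Qed.
Lemma dual_fixed e : cofixedv V e -> fixedv (dualV V) e.
Proof. by move=> h x; rewrite dualVE cofixed_adj // swapE. Qed.
Lemma dual_cofixed e : fixedv V e -> cofixedv (dualV V) e.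
Proof. by move=> h x; rewrite dualVE fixed_adj // swapE. Qed.

(** So z |-> [Lsl V eh z] is compatible with left multiplication by slices. Up to the factor s it
    will be the inverse of x |-> x e. *)
Lemma Lsl_cofixed_mul eh u v z : cofixedv V eh ->
  Lsl V u v *m Lsl V eh z = Lsl V eh (Lsl V u v *m z).
Proof.
move=> h; apply: op_ext => w x.
by rewrite -mulmxA -slice_mulL // h mulmxA -LE op2_Lsl -mulmxA RL.
Qed.

Lemma Rsl_fixed_mul e : fixedv V e -> ip e e = 1 ->
  forall u v, Rsl V e e *m Rsl V u v = ip u v *: Rsl V e e.
Proof.
move=> he e1 u v; apply: op_ext => w x.
rewrite -mulmxA -slice_mulR // !(fixed_adj he) op1E ip_tens -RL.
by rewrite -scalemxAl ipZr mulrC.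
Qed.

Definition Rtr := \sum_k Rsl V (bas k) (bas k).
Definition Ltr := \sum_k Lsl V (bas k) (bas k).

Lemma sum1n (a : C) : \sum_(k < n) a = n%:R * a.
Proof. by rewrite sumr_const card_ord mulr_natl. Qed.

Lemma ip_basbas (k : 'I_n) : ip (bas k) (bas k) = 1.
Proof. by rewrite ip_bas mxE !eqxx. Qed.

Lemma tr_op1 A : \tr (op1 A) = n%:R * \tr A.
Proof.
rewrite mxtrace2 [\tr A]mxtrace_bas mulr_sumr; apply: eq_bigr => i _.
rewrite -sum1n; apply: eq_bigr => j _.
by rewrite op1E ip_tens ip_basbas mulr1.
Qed.
Lemma tr_op2 A : \tr (op2 A) = n%:R * \tr A.
Proof.
rewrite mxtrace2 [\tr A]mxtrace_bas -sum1n; apply: eq_bigr => i _.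
apply: eq_bigr => j _.
by rewrite op2E ip_tens ip_basbas mul1r.
Qed.

(** A coefficient of the product of two partial traces is the full trace of V (L (x) 1) V^* for a
    slice L, and there [V] cancels by cyclicity. *)
Lemma Rtr_idem : Rtr *m Rtr = n%:R *: Rtr.
Proof.
apply: op_ext => u v; rewrite -scalemxAl ipZr -mulmxA /Rtr !mulmx_suml.
under eq_bigr do rewrite mulmx_sumr.
rewrite !ip_sumr; under eq_bigr do rewrite ip_sumr.
under eq_bigr => i _.
  under eq_bigr => j _ do rewrite -slice_mulR // -ip_adj mulmxA mulmxA.
  over.
rewrite -mxtrace2 mxtrace_mulC mulmxA (mu_l HV) mul1mx tr_op1 tr_L.
by [].
Qed.

(** The eigenvalue n forces equality in the Cauchy-Schwarz inequality between z (x) [bas k] and its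
    image, for every k at once: the squared distances add up to zero. *)
Lemma Rtr_fixed z : Rtr *m z = n%:R *: z -> fixedv V z.
Proof.
move=> h.
pose y k := V *m (z *v bas k) - z *v bas k.
have y0 : \sum_k ip (y k) (y k) = 0.
  have t1 : \sum_k ip (z *v bas k) (V *m (z *v bas k)) = n%:R * ip z z.
    rewrite -ipZr -h /Rtr mulmx_suml ip_sumr.
    by apply: eq_bigr => k _; rewrite RE.
  have t2 : \sum_k ip (V *m (z *v bas k)) (z *v bas k) = n%:R * ip z z.
    have := congr1 Num.conj t1; rewrite rmorph_sum rmorphM /= ipC rmorph_nat => <-.
    by apply: eq_bigr => k _; rewrite ipC.
  under eq_bigr => k _.
    rewrite /y ipBr !ipBl (ip_unit _ _ (mu_l HV)) ip_tens ip_basbas mulr1; over.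
  rewrite !big_split /= !sumrN !big_split /= t2 sumrN t1 sum1n.
  by rewrite !subrr.
have yk k : y k = 0.
  apply: ip_eq0; apply/eqP; move/eqP: y0; rewrite psumr_eq0; last by move=> *; exact: ip_ge0.
  by move/allP/(_ k); rewrite mem_index_enum; apply.
move=> x; rewrite [x]bas_exp tens_sumr mulmx_sumr; apply: eq_bigr => k _.
by rewrite tensZr -scalemxAr; congr (_ *: _); apply/eqP; rewrite -subr_eq0 -/(y k) yk.
Qed.

Lemma Rtr_range z : (0 < n)%N -> fixedv V (Rtr *m z).
Proof. by move=> n0; apply: Rtr_fixed; rewrite mulmxA Rtr_idem scalemxAl. Qed.

Lemma Rtr_ip e z : fixedv V e -> ip e (Rtr *m z) = n%:R * ip e z.
Proof.
move=> h; rewrite /Rtr mulmx_suml ip_sumr -sum1n; apply: eq_bigr => k _.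
by rewrite RE ip_adj (fixed_adj h) ip_tens ip_basbas mulr1.
Qed.

Lemma RtrE e : fixedv V e -> ip e e = 1 ->
  (forall z, fixedv V z -> exists c, z = c *: e) ->
  forall z, Rtr *m z = (n%:R * ip e z) *: e.
Proof.
move=> he e1 hl z.
have [|n0] := posnP n => [n0|].
  by apply/colP => i; have := ltn_ord i; rewrite {2}n0.
have [c hc] := hl _ (Rtr_range z n0).
by rewrite -Rtr_ip // hc ipZr e1 mulr1.
Qed.

(** [Rsl V e e] absorbs every slice on its right, hence also [Rtr], which is n times the projection
    onto the line of e. *)
Lemma Rsl_fixedE e : (0 < n)%N -> fixedv V e -> ip e e = 1 ->
  (forall z, fixedv V z -> exists c, z = c *: e) ->
  forall z, Rsl V e e *m z = ip e z *: e.
Proof.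
move=> n0 he e1 hl z.
have n0' : n%:R != 0 :> C by rewrite pnatr_eq0 -lt0n.
have h : Rsl V e e *m Rtr = n%:R *: Rsl V e e.
  rewrite /Rtr mulmx_sumr; under eq_bigr do rewrite Rsl_fixed_mul // ip_basbas scale1r.
  by rewrite sumr_const card_ord scaler_nat.
have := congr1 (mulmx^~ z) h; rewrite /= -mulmxA (RtrE he) //.
rewrite -scalemxAr (fixed_Rsl e e he) e1 scale1r -scalemxAl -scalerA.
by move/(scalerI n0').
Qed.

End MU.

(** Adjoint of [Rtr_range] for the dual: slices act by scalars on the fixed vectors that make up the
    range. *)
Lemma Ltr_mul V u v : munit V -> (0 < n)%N -> Ltr V *m Lsl V u v = ip u v *: Ltr V.
Proof.
move=> HV n0.
have hL : adj_op (Ltr V) = Rtr (dualV V).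
  by rewrite /Ltr adj_op_sum; apply: eq_bigr => k _; rewrite R_dualV.
rewrite -[LHS]adj_opK -[RHS]adj_opK; congr (adj_op _).
rewrite adj_opM adj_opZ hL ipC; apply: mx_ext => x.
have hf := Rtr_range (dualV_munit HV) x n0.
rewrite -mulmxA -R_dualV fixed_Rsl // -scalemxAl; congr (_ *: _).
Qed.

(** The operator z |-> [Lsl V a z *m b]. For a cofixed [a] it commutes with all left slices and is,
    up to normalisation, a right multiplication. *)
Definition Psl V a (b : 'cV[C]_n) : 'M[C]_n := \matrix_(i, j) (Lsl V a (bas j) *m b) i 0.

Lemma PslE V a b z : Psl V a b *m z = Lsl V a z *m b.
Proof.
rewrite Lsl_sumr mulmx_suml; apply/colP => i; rewrite mxE summxE.
by apply: eq_bigr => j _; rewrite mxE -scalemxAl [RHS]mxE mulrC.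
Qed.

(* Both sides come from the trace of [Ltr V *m Z], where [Z] is the slice of [V] by the functional tr (M -). *)
Lemma trace_comm V e M : munit V -> (0 < n)%N -> fixedv V e -> ip e e = 1 ->
  (forall z, fixedv V z -> exists c, z = c *: e) ->
  comm_mx V (op2 M) -> \tr M = n%:R * ip e (M *m e).
Proof.
move=> HV n0 he e1 hl hM.
have n0' : n%:R != 0 :> C by rewrite pnatr_eq0 -lt0n.
pose Z := \sum_k Lsl V (bas k) (M *m bas k).
have h1 : Ltr V *m Z = \tr M *: Ltr V.
  rewrite mulmx_sumr mxtrace_bas scaler_suml; apply: eq_bigr => k _.
  by rewrite Ltr_mul.
have h2 : Ltr V *m Z = n%:R *: Z.
  apply: op_ext => w x; rewrite -scalemxAl ipZr -mulmxA.
  rewrite /Ltr /Z !mulmx_suml.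
  under eq_bigr do rewrite mulmx_sumr.
  rewrite !ip_sumr; under eq_bigr do rewrite ip_sumr.
  under eq_bigr => i _.
    under eq_bigr => j _ do rewrite -slice_mulL // ip_adjl -op2E [V *m _]mulmxA hM !mulmxA.
    over.
  rewrite /= -mxtrace2 -!mulmxA mxtrace_mulC -!mulmxA (mu_r HV) mulmx1 -op2M tr_op2.
  rewrite mxtrace_bas; congr (_ * _); apply: eq_bigr => k _.
  by rewrite -mulmxA RL.
have tZ : \tr Z = n%:R * ip e (M *m e).
  rewrite /Z raddf_sum /=; under eq_bigr => k _ do rewrite tr_L -ip_sumr -mulmx_suml.
  under eq_bigr => k _ do rewrite (RtrE HV he e1 hl) ipZr -mulrA.
  rewrite -mulr_sumr; congr (_ * _); rewrite ip_adj ip_bas_exp.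
  by apply: eq_bigr => k _; rewrite -ip_adj.
have tL : \tr (Ltr V) = n%:R.
  rewrite /Ltr raddf_sum /=; under eq_bigr => k _ do rewrite tr_L -ip_sumr -mulmx_suml.
  under eq_bigr => k _ do rewrite (RtrE HV he e1 hl) ipZr -mulrA.
  by rewrite -mulr_sumr -ip_bas_exp e1 mulr1.
have := congr1 mxtrace h1; rewrite h2 !mxtraceZ tZ tL [RHS]mulrC.
by move/(mulfI n0').
Qed.

(** The normalised operator P : z |-> s^-1 [Lsl V eh z] e lies in the commutant of S, and its
    adjoint fixes e. With N = 1 - P, [trace_comm] gives tr (N N^* ) = n |N^* e|^2 = 0, so P = 1. *)
Lemma cyclic_fixed V e eh s : (0 < n)%N -> munit V -> fixedv V e -> cofixedv V eh ->
  ip e e = 1 -> ip e eh = s -> s^* = s -> s != 0 ->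
  (forall z, fixedv V z -> exists c, z = c *: e) ->
  forall z, Lsl V eh z *m e = s *: z.
Proof.
move=> n0 HV he heh e1 es sr s0 hl z.
have es' : ip eh e = s by rewrite -ipC es.
pose P := s^-1 *: Psl V eh e.
have cP : comm_mx V (op2 P).
  apply/comm_op2P => u v; apply: mx_ext => x.
  rewrite -!mulmxA /P -!scalemxAl !PslE -scalemxAr; congr (_ *: _).
  by rewrite mulmxA Lsl_cofixed_mul.
pose N := 1%:M - P.
have cN : comm_mx V (op2 N).
  apply/comm_op2P => u v; apply: comm_mxB; first exact: comm_mx1.
  by move/comm_op2P: cP; apply.
have cN' : comm_mx V (op2 (adj_op N)).
  have := adj_comm cN; rewrite adj_op2E /comm_mx => h.
  have := congr1 (fun A : 'M_(n * n) => V *m A *m V) h.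
  by rewrite /= !mulmxA (mu_r HV) mul1mx -!mulmxA (mu_l HV) mulmx1 => ->.
have cM : comm_mx V (op2 (N *m adj_op N)).
  by rewrite op2M; apply: comm_mxM.
(* Pairing with e turns the slice at eh into [Rsl V e e], the projection onto the line of e. The
   factor <eh, e> = s cancels the normalisation. *)
have Pe : adj_op P *m e = e.
  apply: ip_ext => w; rewrite -ip_adjl /P -scalemxAl ipZl PslE -[ip _ e]ipC -RL.
  rewrite (Rsl_fixedE HV) // ipZr es' fmorphV /= sr.
  by rewrite rmorphM /= sr ipC mulrC mulfK.
have Ne : adj_op N *m e = 0.
  by rewrite /N adj_opD adj_op1 mulmxDl mul1mx -[- P]scaleN1r adj_opZ rmorphN rmorph1 -scalemxAl Pe scaleN1r subrr.
have := trace_comm HV n0 he e1 hl cM.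
rewrite -mulmxA Ne mulmx0 ip0r mulr0 mxtrace_bas => h.
have N0 : adj_op N = 0.
  apply: mx_ext => x; rewrite mul0mx [x]bas_exp mulmx_sumr big1 // => k _.
  rewrite -scalemxAr (_ : adj_op N *m _ = 0) ?scaler0 //; apply: ip_eq0.
  apply/eqP; move/eqP: h; rewrite psumr_eq0; last first.
    by move=> i _; rewrite -mulmxA ip_adj ip_ge0.
  move/allP/(_ k); rewrite mem_index_enum => /(_ isT).
  by rewrite -mulmxA ip_adj.
have : P *m z = z.
  have N00 : N = 0 by rewrite -[N]adj_opK N0 /adj_op map_mx0 trmx0.
  have /eqP := congr1 (mulmx^~ z) N00.
  by rewrite /N /= mulmxBl mul1mx mul0mx subr_eq0 => /eqP <-.
rewrite /P -scalemxAl PslE => {2}<-.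
by rewrite scalerA divff // scale1r.
Qed.

End Slices.

(** * Kac systems *)

Section VectorFunctional.
Variables (C : numClosedFieldType) (n : nat) (u v : 'cV[C]_n).
Definition vfun (A : 'M[C]_n) : C := ip u (A *m v).
Lemma vfun_scalar : scalar vfun.
Proof. by move=> a A B; rewrite /vfun mulmxDl ipDr -scalemxAl ipZr. Qed.
HB.instance Definition _ := GRing.isLinear.Build C 'M[C]_n C *%R vfun vfun_scalar.
End VectorFunctional.

(* Locked, so that rewriting with associativity does not unfold it. *)
HB.lock Definition cj (C : numClosedFieldType) (n : nat) (U A : 'M[C]_n) : 'M[C]_n :=
  U *m A *m U.

Lemma cjE (C : numClosedFieldType) (n : nat) (U A : 'M[C]_n) : cj U A = U *m A *m U.
Proof. by rewrite unlock. Qed.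

Section Kac.
Variables (C : numClosedFieldType) (n : nat).
Implicit Types (u v w z : 'cV[C]_n) (A B : 'M[C]_n) (V : 'M[C]_(n * n)).
Local Notation "x *v y" := (tens x y) (at level 40, left associativity).
Local Notation bas := (@bas C n).
Local Notation swap := (@swap C n).

Lemma slice_lE V (om : {scalar 'M[C]_n}) :
  slice_l om V = \sum_i \sum_j om (delta_mx i j) *: Lsl V (bas i) (bas j).
Proof.
apply/matrixP => k l; rewrite mxE summxE [X in om X]matrix_sum_delta linear_sum.
apply: eq_bigr => i _; rewrite summxE linear_sum; apply: eq_bigr => j _.
by rewrite linearZ !mxE /= -!bas_tens -mx_bas mulrC.
Qed.

Lemma slice_rE V (om : {scalar 'M[C]_n}) :
  slice_r om V = \sum_i \sum_j om (delta_mx i j) *: Rsl V (bas i) (bas j).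
Proof.
apply/matrixP => k l; rewrite mxE summxE [X in om X]matrix_sum_delta linear_sum.
apply: eq_bigr => i _; rewrite summxE linear_sum; apply: eq_bigr => j _.
by rewrite linearZ !mxE /= -!bas_tens -mx_bas mulrC.
Qed.

Lemma Lsl_slice V u v : slice_l (vfun u v) V = Lsl V u v.
Proof.
rewrite slice_lE Lsl_suml; apply: eq_bigr => i _.
rewrite Lsl_sumr scaler_sumr; apply: eq_bigr => j _.
by rewrite scalerA /= /vfun ip_delta.
Qed.

Lemma Rsl_slice V u v : slice_r (vfun u v) V = Rsl V u v.
Proof.
rewrite slice_rE Rsl_suml; apply: eq_bigr => i _.
rewrite Rsl_sumr scaler_sumr; apply: eq_bigr => j _.
by rewrite scalerA /= /vfun ip_delta.
Qed.

Lemma Sset_Lsl V u v : Sset V (Lsl V u v).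
Proof. by exists (vfun u v); rewrite Lsl_slice. Qed.

Lemma hatSset_Rsl V u v : hatSset V (Rsl V u v).
Proof. by exists (vfun u v); rewrite Rsl_slice. Qed.

Lemma comm_mxZ m (A B : 'M[C]_m) a : comm_mx A B -> comm_mx A (a *: B).
Proof. by rewrite /comm_mx -scalemxAr -scalemxAl => ->. Qed.

Lemma slice_l_comm V A x : (forall u v, comm_mx A (Lsl V u v)) -> Sset V x -> comm_mx A x.
Proof.
move=> h [om ->]; rewrite slice_lE; apply: comm_mx_sum => i _.
by apply: comm_mx_sum => j _; apply: comm_mxZ.
Qed.

Lemma comm_unitary m (A B : 'M[C]_m) : adj_op A *m A = 1%:M -> A *m adj_op A = 1%:M ->
  comm_mx A B -> comm_mx (adj_op A) B.
Proof.
move=> h1 h2 h; rewrite /comm_mx -[LHS]mulmx1 -h2.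
by rewrite !mulmxA -[_ *m B *m A]mulmxA -h mulmxA h1 mul1mx.
Qed.

(** Multiplicity 1 is replaced by the identity [g_cyc], because this makes the data self-dual: the
    adjoint of [g_cyc] is the same identity for [dualV V], while the uniqueness of fixed vectors is
    recovered in [fixed_line]. *)
Record good s V e eh : Prop := Good {
  g_n : (0 < n)%N;
  g_mu : munit V;
  g_fix : fixedv V e;
  g_cofix : cofixedv V eh;
  g_e1 : ip e e = 1;
  g_eh1 : ip eh eh = 1;
  g_s : ip e eh = s;
  g_s0 : 0 < s;
  g_cyc : forall z, Lsl V eh z *m e = s *: z }.

Section Good.
Variables (s : C) (V : 'M[C]_(n * n)) (e eh : 'cV[C]_n).
Hypothesis G : good s V e eh.

Lemma sreal : s^* = s.
Proof. by apply/CrealP; rewrite ger0_real // ltW // (g_s0 G). Qed.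
Lemma sn0 : s != 0. Proof. exact: lt0r_neq0 (g_s0 G). Qed.
Lemma g_s' : ip eh e = s. Proof. by rewrite -ipC (g_s G) sreal. Qed.
Lemma ssV : s^-1^* = s^-1. Proof. by rewrite fmorphV /= sreal. Qed.

Lemma dualV_good : good s (dualV V) eh e.
Proof.
have HV := g_mu G; split; try by case: G.
- exact: dualV_munit.
- exact: dual_fixed (g_cofix G).
- exact: dual_cofixed (g_fix G).
- exact: g_s'.
- move=> z; apply: ip_ext => w; rewrite L_dualV -ip_adjl -ipC RL (g_cyc G).
  by rewrite ipZr rmorphM /= sreal ipC ipZr.
Qed.

Lemma fixed_line z : fixedv V z -> exists c, z = c *: e.
Proof.
move=> h; exists (s^-1 * ip eh z).
have := g_cyc G z; rewrite (fixed_Lslr _ h) mul_scalar_mx -scalerA => ->.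
by rewrite scalerA mulVf ?scale1r // sn0.
Qed.

Lemma R_ee z : Rsl V e e *m z = ip e z *: e.
Proof. by case: G => *; apply: Rsl_fixedE => //; exact: fixed_line. Qed.

Lemma tr_Lsl u v : \tr (Lsl V u v) = n%:R * ip e (Lsl V u v *m e).
Proof.
rewrite tr_L -ip_sumr -mulmx_suml -/(Rtr V).
by rewrite (RtrE (g_mu G) (g_fix G) (g_e1 G) fixed_line) -RL R_ee !ipZr mulrA.
Qed.

Lemma Lsl_ehM u v z : Lsl V u v *m Lsl V eh z = Lsl V eh (Lsl V u v *m z).
Proof. exact (Lsl_cofixed_mul (g_mu G) _ _ _ (g_cofix G)). Qed.

Lemma Lsl_ehe : Lsl V eh e = s%:M.
Proof. by rewrite (fixed_Lslr _ (g_fix G)) g_s'. Qed.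

Lemma Lsl_lam u v : s *: Lsl V u v = Lsl V eh (Lsl V u v *m e).
Proof.
by rewrite -Lsl_ehM Lsl_ehe mul_mx_scalar.
Qed.

(** The vector state of e is a trace on S, since [tr_Lsl] identifies it there with the normalised
    matrix trace. *)
Lemma haar_sym x y : ip e (Lsl V eh x *m y) = ip e (Lsl V eh y *m x).
Proof.
have n0 : n%:R != 0 :> C by rewrite pnatr_eq0 -lt0n (g_n G).
have h a b : \tr (Lsl V eh a *m Lsl V eh b) = n%:R * (s * ip e (Lsl V eh a *m b)).
  by rewrite Lsl_ehM tr_Lsl (g_cyc G) ipZr.
have := h x y; rewrite mxtrace_mulC h => /(mulfI n0) /(mulfI sn0) ->.
by [].
Qed.

Lemma swap_adj_eh_e : swap *m (adj_op V *m (eh *v e)) = adj_op V *m (eh *v e).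
Proof.
apply: ip2_ext => u v; rewrite ip_adj adj_swap swapE -!ip_adjl.
by rewrite -ipC -[RHS]ipC -!LE haar_sym.
Qed.

(* The element x of S with x e = z. *)
Definition lam z : 'M[C]_n := s^-1 *: Lsl V eh z.

Lemma lam_e z : lam z *m e = z.
Proof. by rewrite /lam -scalemxAl (g_cyc G) scalerA mulVf ?scale1r ?sn0. Qed.

Lemma Lsl_lamM u v z : Lsl V u v *m lam z = lam (Lsl V u v *m z).
Proof. by rewrite /lam -scalemxAr Lsl_ehM. Qed.

Lemma lamZ a z : lam (a *: z) = a *: lam z.
Proof.
apply: op_ext => w x; rewrite /lam -!scalemxAl !ipZr !LE tensZl -scalemxAr ipZr.
by rewrite mulrCA.
Qed.
Lemma lamD y z : lam (y + z) = lam y + lam z.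
Proof.
apply: op_ext => w x; rewrite mulmxDl ipDr /lam -!scalemxAl !ipZr !LE tensDl.
by rewrite mulmxDr ipDr mulrDr.
Qed.

Lemma lam1 : lam e = 1%:M.
Proof. by rewrite /lam Lsl_ehe scale_scalar_mx mulVf ?sn0. Qed.

(* The right multiplication x e |-> x b on S e = H. *)
Definition ract b : 'M[C]_n := s^-1 *: Psl V eh b.

Lemma ractE b z : ract b *m z = lam z *m b.
Proof. by rewrite /ract -scalemxAl PslE /lam -scalemxAl. Qed.

Lemma ract_e b : ract b *m e = b.
Proof. by rewrite ractE lam1 mul1mx. Qed.

Lemma comm_ract b u v : comm_mx (Lsl V u v) (ract b).
Proof.
apply: mx_ext => z.
by rewrite -!mulmxA !ractE mulmxA Lsl_lamM.
Qed.

Lemma V_ract b : comm_mx V (op2 (ract b)).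
Proof. by apply/comm_op2P => u v; exact: comm_ract. Qed.

Lemma adjV_comm M : comm_mx V M -> comm_mx (adj_op V) M.
Proof. exact: comm_unitary (mu_l (g_mu G)) (mu_r (g_mu G)). Qed.

Lemma adjV_ract b : comm_mx (adj_op V) (op2 (ract b)).
Proof. exact/adjV_comm/V_ract. Qed.

Lemma comm_ractP x : (forall b, comm_mx x (ract b)) -> x = lam (x *m e).
Proof.
move=> h; apply: mx_ext => z.
by rewrite -{1}(ract_e z) mulmxA h -mulmxA ractE.
Qed.

Lemma Sset_lam z : Sset V (lam z).
Proof.
rewrite /lam [s^-1 *: _](_ : _ = Lsl V (s^-1 *: eh) z); first exact: Sset_Lsl.
by apply: op_ext => w x; rewrite -scalemxAl ipZr !LE tensZl ipZl ssV.
Qed.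

Lemma SsetP x : Sset V x <-> x = lam (x *m e).
Proof.
split=> [h|->]; last exact: Sset_lam.
by apply: comm_ractP => b; apply/comm_mx_sym/(slice_l_comm _ h) => u v; apply/comm_mx_sym/comm_ract.
Qed.

(** S is a commutant, which is why it is closed under products; the adjoint of [V] commuting with
    right multiplications gives closure under adjoints. *)
Lemma comm_Sset x : (forall b, comm_mx x (ract b)) <-> Sset V x.
Proof.
split=> [/comm_ractP /SsetP //|/SsetP -> b].
by rewrite /lam; apply/comm_mx_sym/comm_mxZ/comm_mx_sym/comm_ract.
Qed.

Lemma Sset_mul x y : Sset V x -> Sset V y -> Sset V (x *m y).
Proof.
move=> /comm_Sset hx /comm_Sset hy; apply/comm_Sset => b.
by apply: comm_mx_sym; apply: comm_mxM; apply: comm_mx_sym.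
Qed.

Lemma Sset_adj x : Sset V x -> Sset V (adj_op x).
Proof.
move/SsetP => ->; apply/comm_Sset => b.
rewrite /lam adj_opZ ssV -Lsl_adj; apply/comm_mx_sym/comm_mxZ/comm_mx_sym.
by have /comm_op2P := adjV_ract b; apply.
Qed.

Lemma Sset_lamM x z : Sset V x -> x *m lam z = lam (x *m z).
Proof.
move=> h; have /SsetP -> := Sset_mul h (Sset_lam z).
by rewrite -mulmxA lam_e.
Qed.

End Good.

Lemma swap_V_eh_e s V e eh : good s V e eh -> swap *m (V *m (eh *v e)) = V *m (eh *v e).
Proof.
move=> G; have := swap_adj_eh_e (dualV_good G).
rewrite adj_dualVE mulmxA swapK mul1mx => h.
exact: esym h.
Qed.

(** * The unitary of the antipode and the commutant of S *)

Record kac s V e eh U : Prop := Kac {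
  k_good : good s V e eh;
  k_U1 : adj_op U *m U = 1%:M;
  k_U2 : U *m adj_op U = 1%:M;
  k_U : forall z, op2 U *m (V *m (z *v e)) = adj_op V *m (z *v e) }.

Lemma tens_injl x y z : ip z z = 1 -> x *v z = y *v z -> x = y.
Proof.
by move=> h1 h; apply: ip_ext => w; have := congr1 (ip (w *v z)) h; rewrite !ip_tens h1 !mulr1.
Qed.
Lemma tens_injr x y z : ip z z = 1 -> z *v x = z *v y -> x = y.
Proof.
by move=> h1 h; apply: ip_ext => w; have := congr1 (ip (z *v w)) h; rewrite !ip_tens h1 !mul1r.
Qed.

Section KacTheory.
Variables (s : C) (V : 'M[C]_(n * n)) (e eh : 'cV[C]_n) (U : 'M[C]_n).
Hypothesis K : kac s V e eh U.
Let G := k_good K.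
Let HV := g_mu G.
Local Notation lam := (lam s V eh).
Local Notation ract := (ract s V eh).

Lemma U_e : U *m e = e.
Proof.
apply: (@tens_injr _ _ e (g_e1 G)).
by rewrite -op2E -{1}(g_fix G e) (k_U K) (fixed_adj HV (g_fix G)).
Qed.

Lemma U_Lsl u v : U *m (Lsl V u v *m e) = adj_op (Lsl V v u) *m e.
Proof. by apply: ip_ext => w; rewrite mulmxA -op2_Lsl -Lsl_adj !LE -mulmxA (k_U K). Qed.

(** For b = e, both V (eh (x) e) and V^* (eh (x) e) are invariant under the flip, so [U] can change
    legs in [k_U]. Right multiplications on the second leg give the other b. *)
Lemma op1U_eh b : op1 U *m (V *m (eh *v b)) = adj_op V *m (eh *v b).
Proof.
have h : op1 U *m (V *m (eh *v e)) = adj_op V *m (eh *v e).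
  rewrite -(swap_V_eh_e G) mulmxA -swap2 -mulmxA (k_U K); exact: swap_adj_eh_e G.
rewrite -(ract_e G b) -op2E 2!mulmxA -[_ *m V *m _]mulmxA (V_ract G) mulmxA op12.
by rewrite -mulmxA -mulmxA h mulmxA -(adjV_ract G) -mulmxA.
Qed.

Lemma U_eh : U *m eh = eh.
Proof.
apply: (@tens_injl _ _ eh (g_eh1 G)).
by rewrite -op1E -{1}(g_cofix G eh) op1U_eh (cofixed_adj HV (g_cofix G)).
Qed.

Lemma adj_R_ee : adj_op (Rsl V e e) = Rsl V e e.
Proof.
apply: op_ext => w x; rewrite -ip_adjl !(R_ee G) ipZl ipZr ipC.
by rewrite mulrC.
Qed.

(** Self-adjointness of [Rsl V e e] gives <e, x y e> = <e, y U^2 x e> for slices x, y, while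
    traciality gives <e, y x e>. Hence U^2 fixes S e, which is everything. *)
Lemma UU : U *m U = 1%:M.
Proof.
have h1 u v u' v' : ip e (Lsl V u v *m (Lsl V u' v' *m e)) =
    ip e (Lsl V u' v' *m (U *m (U *m (Lsl V u v *m e)))).
  rewrite -slice_mulL // -adj_R_ee -adj_op2E -ip_adjl -ipC slice_mulL // ipC.
  rewrite [LHS]ip_adjl -U_Lsl -[LHS](ip_unit _ _ (k_U1 K)) (U_Lsl v' u').
  by rewrite -ip_adj.
have h2 u z : ip (U *m u) z = ip (U *m u) (U *m (U *m z)).
  have h3 t : ip e (Lsl V u eh *m t) = s * ip (U *m u) t.
    rewrite ip_adj -U_Lsl (g_cyc G) -scalemxAr ipZl; congr (_ * _).
    exact: sreal G.
  apply: (mulfI (sn0 G)); rewrite -!h3; apply: (mulfI (sn0 G)).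
  have := h1 eh z u eh; rewrite (haar_sym G) (g_cyc G) -!scalemxAr ipZr => <-.
  by rewrite -(Lsl_lam G) -scalemxAl ipZr.
apply: mx_ext => z; apply: ip_ext => w; rewrite mul1mx -mulmxA.
have -> : w = U *m (adj_op U *m w) by rewrite mulmxA (k_U2 K) mul1mx.
by rewrite -h2.
Qed.

Lemma UK (x : 'cV_n) : U *m (U *m x) = x. Proof. by rewrite mulmxA UU mul1mx. Qed.
Lemma adjU : adj_op U = U.
Proof. by rewrite -[LHS]mulmx1 -UU mulmxA (k_U1 K) mul1mx. Qed.
Lemma ipU x y : ip (U *m x) y = ip x (U *m y).
Proof. by rewrite ip_adjl adjU. Qed.
Lemma op1UK M : op1 U *m (op1 U *m M) = M :> 'cV_(n * n).
Proof. by rewrite mulmxA -op1M UU op1_1 mul1mx. Qed.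
Lemma dualV_kac : kac s (dualV V) eh e U.
Proof.
split; [exact: dualV_good G| exact: k_U1 K | exact: k_U2 K |] => z.
rewrite dualVE adj_dualVE mulmxA -swap1 -mulmxA -op1U_eh.
by rewrite op1UK.
Qed.

(** The antipode reverses products: s z is the value at e of the slice [Lsl V eh z], and its
    antipode comes out on the left. *)
Lemma U_anti u v z : U *m (Lsl V u v *m (s *: z)) = adj_op (Lsl V z eh) *m (U *m (Lsl V u v *m e)).
Proof.
have h u' v' : U *m (Lsl V u v *m (Lsl V u' v' *m e)) =
   adj_op (Lsl V v' u') *m (adj_op (Lsl V v u) *m e).
  apply: ip_ext => w; rewrite -ipU -slice_mulL //.
  have -> : Rsl V (U *m w) e = adj_op (Rsl V e w).
    apply: op_ext => a b; rewrite -ip_adjl RL ipU U_Lsl -ip_adjl -ipC -[RHS]ipC.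
    by rewrite RL.
  rewrite -adj_op2E -ip_adjl -ipC slice_mulL // ipC.
  by rewrite !ip_adjl.
by rewrite -(g_cyc G) h U_Lsl.
Qed.

Lemma adj_Lsl_U z : adj_op (Lsl V (U *m z) eh) = Lsl V eh z.
Proof.
apply: op_ext => w x; rewrite -ip_adjl -ipC LE LE.
have -> : (U *m z) *v x = op1 U *m (z *v x) by rewrite op1E.
by rewrite ip_adjl adj_op1E adjU op1U_eh -ip_adjl -ipC conjCK.
Qed.

(** Being antimultiplicative, [U] changes left multiplications into right ones. Hence U S U is the
    algebra of right multiplications and S is its commutant ([Sset_bicomm]). *)
Lemma U_conj u v : U *m Lsl V u v *m U = ract (U *m (Lsl V u v *m e)).
Proof.
apply: mx_ext => z; rewrite ractE -!mulmxA /lam -scalemxAl -adj_Lsl_U.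
by rewrite -U_anti -!scalemxAr scalerA mulVf ?scale1r // (sn0 G).
Qed.

Lemma ract_lam b : ract b = U *m lam (U *m b) *m U.
Proof.
rewrite /lam -scalemxAr -scalemxAl U_conj (g_cyc G) -!scalemxAr UK.
apply: mx_ext => z; rewrite -scalemxAl !ractE -!scalemxAr scalerA mulVf ?scale1r //.
exact: sn0 G.
Qed.

Local Notation cj := (cj U).

Lemma cjK A : cj (cj A) = A.
Proof. by rewrite !cjE !mulmxA UU mul1mx -mulmxA UU mulmx1. Qed.
Lemma cjM A B : cj (A *m B) = cj A *m cj B.
Proof. by rewrite !cjE !mulmxA -[_ *m U *m U]mulmxA UU mulmx1. Qed.
Lemma cj_adj A : adj_op (cj A) = cj (adj_op A).
Proof. by rewrite !cjE !adj_opM adjU mulmxA. Qed.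
Lemma comm_cj A B : comm_mx A B -> comm_mx (cj A) (cj B).
Proof. by rewrite /comm_mx -!cjM => ->. Qed.
Lemma comm_cjl A B : comm_mx (cj A) B -> comm_mx A (cj B).
Proof. by move/comm_cj; rewrite cjK. Qed.
Lemma comm_cjr A B : comm_mx A (cj B) -> comm_mx (cj A) B.
Proof. by move/comm_cj; rewrite cjK. Qed.

Lemma Sset_ract x : Sset V x -> cj x = ract (U *m (x *m e)).
Proof. by move/(SsetP G) => ->; rewrite cjE ract_lam (lam_e G) UK. Qed.

Lemma Sset_comm x y : Sset V x -> Sset V y -> comm_mx x (cj y).
Proof. by move=> /(comm_Sset G) h /Sset_ract ->; apply: h. Qed.

Lemma Sset_bicomm x : (forall y, Sset V y -> comm_mx x (cj y)) -> Sset V x.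
Proof.
move=> h; apply/(comm_Sset G) => b; rewrite ract_lam -cjE; apply: h.
exact: Sset_lam G _.
Qed.

Lemma V_comm2 y : Sset V y -> comm_mx V (op2 (cj y)).
Proof. by move=> hy; apply/comm_op2P => u v; apply: Sset_comm hy; exact: Sset_Lsl. Qed.
Lemma adjV_comm2 y : Sset V y -> comm_mx (adj_op V) (op2 (cj y)).
Proof. by move=> hy; apply: (adjV_comm G); exact: V_comm2. Qed.

Lemma cj_cyc z : exists2 y, Sset V y & cj y *m e = z.
Proof.
exists (lam (U *m z)); first exact: Sset_lam G _.
by rewrite cjE -ract_lam (ract_e G).
Qed.

(* Here and below [V *m op1 x *m adj_op V] is the coproduct of x. *)
Lemma comul_comm1 x y : Sset V x -> Sset V y -> comm_mx (V *m op1 x *m adj_op V) (op1 (cj y)).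
Proof.
move=> hx hy; apply: comm_mx_sym.
have [om ->] := hx; rewrite slice_lE op1_sum mulmx_sumr mulmx_suml.
apply: comm_mx_sum => i _; rewrite op1_sum mulmx_sumr mulmx_suml.
apply: comm_mx_sum => j _; rewrite op1Z -scalemxAr -scalemxAl; apply: comm_mxZ.
rewrite (mu_pL HV) -mulmxA (mu_r HV) mulmx1; apply: comm_mx_sum => k _.
apply: comm_mxM; last by apply: op12.
rewrite /comm_mx -!op1M; congr op1; apply: comm_mx_sym.
by apply: Sset_comm => //; exact: Sset_Lsl.
Qed.

(** The counit identity: S acts on eh through a character, the counit, which is applied here to the
    first leg of the coproduct. *)
Lemma comul_eh x z : Sset V x -> V *m (op1 x *m (adj_op V *m (eh *v z))) = eh *v (x *m z).
Proof.
move=> [om ->]; rewrite slice_lE.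
have h u v : V *m (op1 (Lsl V u v) *m (adj_op V *m (eh *v z))) = eh *v (Lsl V u v *m z).
  rewrite !mulmxA (mu_pL HV) -[_ *m V *m _]mulmxA (mu_r HV) mulmx1 mulmx_suml.
  under eq_bigr do rewrite -mulmxA op2E op1E (cofixed_Lsl _ _ (g_cofix G)) tensZl -tensZr.
  rewrite -tens_sumr; congr (_ *v _).
  apply: ip_ext => w; rewrite LE {2}[u]bas_exp tens_suml ip_suml ip_sumr.
  by apply: eq_bigr => k _; rewrite ipZr tensZl ipZl LE ipC.
rewrite op1_sum mulmx_suml mulmx_sumr mulmx_suml tens_sumr; apply: eq_bigr => i _.
rewrite op1_sum mulmx_suml mulmx_sumr mulmx_suml tens_sumr; apply: eq_bigr => j _.
by rewrite op1Z -scalemxAl -scalemxAr h -scalemxAl tensZr.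
Qed.

End KacTheory.

End Kac.

(** * Pre-subgroups *)

Section PreSubgroup.
Variables (C : numClosedFieldType) (n : nat).
Implicit Types (u v w z : 'cV[C]_n) (A B : 'M[C]_n) (V : 'M[C]_(n * n)).
Local Notation "x *v y" := (tens x y) (at level 40, left associativity).
Local Notation bas := (@bas C n).
Local Notation swap := (@swap C n).

Section Proj.
Variables (V : 'M[C]_(n * n)) (f : 'cV[C]_n).
Hypotheses (HV : munit V) (f1 : ip f f = 1) (Vff : V *m (f *v f) = f *v f).

Lemma Rff_idem : Rsl V f f *m Rsl V f f = Rsl V f f.
Proof.
apply: op_ext => u v.
by rewrite -mulmxA -slice_mulR // !(adj_fix (mu_l HV) Vff) op1E ip_tens f1 mulr1 -RL.
Qed.

(** [V] preserves norms, so the inner product of z (x) f with its image attains its maximum only if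
    the two vectors coincide. *)
Lemma Rff_fixP z : Rsl V f f *m z = z <-> Hlow V f z.
Proof.
split=> [h|h]; last by apply: ip_ext => w; rewrite RE h ip_tens f1 mulr1.
apply: norm_eq; first by rewrite (ip_unit _ _ (mu_l HV)).
by rewrite -RE h ip_tens f1 mulr1.
Qed.

(** Vectors fixed by [V] are fixed by its adjoint. Thus the idempotent P satisfies P^* P = P, and
    the left side is self-adjoint. *)
Lemma Rff_adj : adj_op (Rsl V f f) = Rsl V f f.
Proof.
have h : adj_op (Rsl V f f) *m Rsl V f f = Rsl V f f.
  apply: mx_ext => z; rewrite -mulmxA -Rsl_adj.
  have /Rff_fixP hf : Rsl V f f *m (Rsl V f f *m z) = Rsl V f f *m z by rewrite mulmxA Rff_idem.
  by apply: ip_ext => w; rewrite RE (adj_fix (mu_l HV) hf) ip_tens f1 mulr1.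
by rewrite -{1}h adj_opM adj_opK h.
Qed.

End Proj.

Lemma dual_ff V f : munit V -> V *m (f *v f) = f *v f -> dualV V *m (f *v f) = f *v f.
Proof. by move=> HV h; rewrite dualVE (adj_fix (mu_l HV)) // swapE. Qed.

Lemma Hlow_dual V f z : munit V -> Hlow (dualV V) f z <-> Hup V f z.
Proof.
move=> HV; rewrite /Hlow /Hup dualVE; split=> h.
  have := congr1 (mulmx swap) h; rewrite mulmxA swapK mul1mx swapE => h2.
  by rewrite -{1}h2 mulmxA (mu_r HV) mul1mx.
by rewrite (adj_fix (mu_l HV) h) swapE.
Qed.

Lemma Hup_dual V f z : munit V -> Hup (dualV V) f z <-> Hlow V f z.
Proof. by move=> HV; rewrite -{2}(dualVK V) Hlow_dual //; exact: dualV_munit. Qed.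

Lemma proj_eq (P Q : 'M[C]_n) : P *m P = P -> Q *m Q = Q -> adj_op P = P -> adj_op Q = Q ->
  (forall z, P *m z = z <-> Q *m z = z) -> P = Q.
Proof.
move=> PP QQ aP aQ h.
have QP : Q *m P = P by apply: mx_ext => z; rewrite -mulmxA; apply/h; rewrite mulmxA PP.
have PQ : P *m Q = Q by apply: mx_ext => z; rewrite -mulmxA; apply/h; rewrite mulmxA QQ.
by rewrite -[LHS]aP -[in LHS]QP adj_opM aP aQ PQ.
Qed.

Section Pre.
Variables (s : C) (V : 'M[C]_(n * n)) (e eh : 'cV[C]_n) (U : 'M[C]_n).
Hypothesis K : kac s V e eh U.
Let G := k_good K.
Let HV := g_mu G.
Local Notation lam := (lam s V eh).
Local Notation cj := (cj U).

Section One.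
Variable f : 'cV[C]_n.
Hypothesis pf : presubgroup V e f.

Let f1 : ip f f = 1. Proof. by case: pf. Qed.
Let Vff : V *m (f *v f) = f *v f. Proof. by case: pf => _ []. Qed.

Lemma pre_e : ip e f = ip f e.
Proof. by case: pf => _ [h _]; rewrite -ipC; apply/CrealP; rewrite ger0_real // ltW. Qed.
Lemma pre_gt0 : 0 < ip e f.
Proof. by rewrite pre_e; case: pf => _ []. Qed.
Lemma pre_n0 : ip e f != 0.
Proof. exact: lt0r_neq0 pre_gt0. Qed.

Lemma Rff_e : Rsl V f f *m e = e.
Proof. by rewrite (fixed_Rsl _ _ (g_fix G)) f1 scale1r. Qed.
Lemma Lff_eh : Lsl V f f *m eh = eh.
Proof. by rewrite (cofixed_Lsl _ _ (g_cofix G)) f1 scale1r. Qed.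
(** The first leg of the coproduct commutes with U S U, for which e is cyclic. This leaves z = e,
    where the claim is the hypothesis on x e. *)
Lemma low_comul x z : Sset V x -> Hlow V f (x *m e) ->
  V *m (op1 x *m (adj_op V *m (z *v f))) = (x *m z) *v f.
Proof.
move=> hx h; have [y hy <-] := cj_cyc K z.
rewrite -op1E 2!mulmxA mulmxA (comul_comm1 K hx hy) -!mulmxA (fixed_adj HV (g_fix G)) op1E h.
by rewrite op1E !mulmxA (Sset_comm K hx hy).
Qed.

Lemma low_adjV x z : Sset V x -> Hlow V f (x *m e) ->
  op1 x *m (adj_op V *m (z *v f)) = adj_op V *m ((x *m z) *v f).
Proof. by move=> hx h; rewrite -low_comul // [RHS]mulmxA (mu_l HV) mul1mx. Qed.

Lemma Gset_comm x : Gset V e f x -> comm_mx x (Rsl V f f).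
Proof.
case=> hx h; apply: op_ext => w z; rewrite -(Rff_adj HV f1 Vff) -Rsl_adj -!mulmxA.
by rewrite [LHS]ip_adj !RE -low_adjV // [RHS]ip_adj adj_op1E op1E.
Qed.

(** Commutation with a self-adjoint projection shows what the definition hides, namely that G_f is
    closed under adjoints. *)
Lemma GsetP x : Gset V e f x <-> Sset V x /\ comm_mx x (Rsl V f f).
Proof.
split=> [h|[hx h]]; first by split; [case: h | exact: Gset_comm].
by split=> //; apply/(Rff_fixP HV f1); rewrite mulmxA -h -mulmxA Rff_e.
Qed.

Lemma Gset_adj x : Gset V e f x -> Gset V e f (adj_op x).
Proof.
move=> /GsetP [hx h]; apply/GsetP; split; first exact: Sset_adj G _ hx.
by rewrite -(Rff_adj HV f1 Vff); apply: adj_comm.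
Qed.

(** In other words, G_f acts on f through the counit. *)
Lemma low_eig z : Hlow V f z -> Lsl V eh z *m f = ip eh z *: f.
Proof. by move=> h; apply: ip_ext => w; rewrite LE h ip_tens ipZr. Qed.

Let a := Lsl V eh f.

(** The adjoint of a lies in G_f, hence maps f to a multiple of f by [low_eig], and a is s times the
    element of S represented by f. *)
Let aa : adj_op a *m a = (ip eh f)^* *: a.
Proof.
have ha : Gset V e f a.
  split; first exact: Sset_Lsl.
  by rewrite /Hlow (g_cyc G) tensZl -scalemxAr Vff.
have [ha1 ha2] := Gset_adj ha.
have : s *: (adj_op a *m lam f) = s *: lam (adj_op a *m f) by rewrite (Sset_lamM G).
rewrite {1}/lam -scalemxAr scalerA mulfV ?(sn0 G) // scale1r => ->.
have /(SsetP G) h3 := ha1.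
rewrite {1}h3 /lam -scalemxAl low_eig // -ip_adjl (cofixed_Lsl _ _ (g_cofix G)).
rewrite ipZl (g_s' G) scalerA mulrCA mulVf ?(sn0 G) // mulr1 /a.
have -> (c : C) : Lsl V eh (c *: f) = c *: Lsl V eh f.
  by apply: op_ext => w x; rewrite -scalemxAl ipZr !LE tensZl -scalemxAr ipZr.
by rewrite !scalerA mulfV ?(sn0 G) // mul1r.
Qed.

(** The vector state of e evaluated on [aa]. Since s and <e, f> are positive, so is <eh, f>; this
    makes f a pre-subgroup of the dual as well. *)
Lemma pre_ehC : (ip eh f)^* * ip e f = s.
Proof.
have := congr1 (fun A => ip e (A *m e)) aa.
rewrite -mulmxA /= -ip_adjl /a !(g_cyc G) -scalemxAl !(g_cyc G) ipZl !ipZr f1 (sreal G) mulr1.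
by rewrite mulrCA => /(mulfI (sn0 G)) ->.
Qed.

Lemma pre_eh_gt0 : 0 < ip eh f.
Proof.
have h : (ip eh f)^* = s / ip e f by rewrite -pre_ehC mulfK // pre_n0.
have h0 : 0 < (ip eh f)^* by rewrite h divr_gt0 ?pre_gt0 // (g_s0 G).
by rewrite -[ip eh f]conjCK (CrealP _) // ger0_real // ltW.
Qed.

Lemma pre_ehR : (ip eh f)^* = ip eh f.
Proof. by apply/CrealP; rewrite ger0_real // ltW // pre_eh_gt0. Qed.
Lemma pre_eh : ip eh f * ip e f = s.
Proof. by rewrite -pre_ehR pre_ehC. Qed.
Lemma pre_eh_n0 : ip eh f != 0.
Proof. exact: lt0r_neq0 pre_eh_gt0. Qed.

Lemma dual_pre : presubgroup (dualV V) eh f.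
Proof.
split=> //; split; last exact: dual_ff.
by rewrite -ipC pre_ehR pre_eh_gt0.
Qed.

Let a_adj : adj_op a = a.
Proof.
have := congr1 (@adj_op C n) aa; rewrite adj_opM adj_opK aa adj_opZ conjCK pre_ehR.
by move/(scalerI pre_eh_n0).
Qed.

Lemma Lff_adj : adj_op (Lsl V f f) = Lsl V f f.
Proof.
have := Rff_adj (dualV_munit HV) f1 (dual_ff HV Vff).
by rewrite R_dualV adj_opK => <-.
Qed.

Lemma Lff_idem : Lsl V f f *m Lsl V f f = Lsl V f f.
Proof.
have := Rff_idem (dualV_munit HV) f1 (dual_ff HV Vff).
by rewrite R_dualV Lff_adj.
Qed.

Lemma Lff_fixP z : Lsl V f f *m z = z <-> Hup V f z.
Proof.
have := Rff_fixP (dualV_munit HV) f1 z; rewrite R_dualV Lff_adj => ->.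
exact: Hlow_dual.
Qed.

(** Both are orthogonal projections onto H^f. It follows that the projection onto H^f maps e to a
    multiple of f, and that f is cyclic for U S U in H^f. *)
Lemma LffE : Lsl V f f = (ip eh f)^-1 *: a.
Proof.
have g0 := pre_eh_n0.
have gr : (ip eh f)^-1^* = (ip eh f)^-1 by rewrite fmorphV /= pre_ehR.
apply: proj_eq; [exact: Lff_idem | | exact: Lff_adj | | ].
- rewrite -scalemxAl -scalemxAr scalerA -{1}a_adj aa pre_ehR scalerA -mulrA mulVf //.
  by rewrite mulr1.
- by rewrite adj_opZ a_adj gr.
move=> z; split=> h.
- apply: ip_ext => w; rewrite -scalemxAl ipZr LE.
  by move/Lff_fixP: h => ->; rewrite ip_tens mulKf.
(* The operator commutes with U S U, so its range is generated from its value at e, a multiple of f,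
   and f lies in H^f. *)
- apply/Lff_fixP; rewrite -h; have [y hy <-] := cj_cyc K z.
  have hb : comm_mx ((ip eh f)^-1 *: a) (cj y).
    by apply/comm_mx_sym/comm_mxZ/comm_mx_sym/(Sset_comm K _ hy)/Sset_Lsl.
  rewrite mulmxA hb -mulmxA -scalemxAl (g_cyc G) scalerA -scalemxAr /Hup tensZr -scalemxAr.
  by rewrite -op2E [in LHS]mulmxA (V_comm2 K hy) -mulmxA Vff.
Qed.

Lemma Lff_e : Lsl V f f *m e = ip e f *: f.
Proof.
by rewrite LffE -scalemxAl (g_cyc G) scalerA -pre_eh mulKf // pre_eh_n0.
Qed.

Lemma U_f : U *m f = f.
Proof.
have := U_Lsl K f f; rewrite Lff_adj Lff_e -scalemxAr.
by move/(scalerI pre_n0).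
Qed.

Lemma Hup_cyc z : Hup V f z -> exists2 y, Sset V y & cj y *m f = z.
Proof.
move/Lff_fixP => <-; have [y hy <-] := cj_cyc K z.
exists (ip e f *: y).
  apply/(comm_Sset G) => b; apply/comm_mx_sym/comm_mxZ/comm_mx_sym.
  by move/(comm_Sset G): hy; apply.
rewrite mulmxA (Sset_comm K (Sset_Lsl _ _ _) hy) -mulmxA Lff_e !cjE.
by rewrite -!(scalemxAl, scalemxAr).
Qed.

End One.

Lemma dual_Rff f : presubgroup V e f -> Lsl (dualV V) f f = Rsl V f f.
Proof. by case=> f1 [_ Vff]; rewrite L_dualV (Rff_adj HV f1 Vff). Qed.
Lemma dual_Lff f : presubgroup V e f -> Rsl (dualV V) f f = Lsl V f f.
Proof. by move=> pf; rewrite R_dualV Lff_adj. Qed.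

End Pre.

(** * Two pre-subgroups with the extremal inner product *)

Section PreDual.
Variables (s : C) (V : 'M[C]_(n * n)) (e eh : 'cV[C]_n) (U : 'M[C]_n).
Hypothesis K : kac s V e eh U.
Let G := k_good K.

Lemma Rff_eh f : presubgroup V e f -> Rsl V f f *m eh = ip eh f *: f.
Proof.
move=> pf; have := Lff_e (dualV_kac K) (dual_pre K pf).
by rewrite (dual_Rff K).
Qed.

Lemma Rff_Sset f : presubgroup V e f -> Sset (dualV V) (Rsl V f f).
Proof. by move=> pf; rewrite -(dual_Rff K pf); exact: Sset_Lsl. Qed.

Section Pair.
Variables f g : 'cV[C]_n.
Hypotheses (pf : presubgroup V e f) (pg : presubgroup V e g) (fg : ip f g = s).

(** The conjugate r of [Lsl V g g] by [U] is a projection with r e = <e, g> g that commutes with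
    [Lsl V f f]. So the norm reduces to <r e, [Lsl V f f] e>, that is, to <g, f>. *)
Lemma pair_norm :
  ip (Lsl V f f *m g) (Lsl V f f *m g) * ip e g = s * ip e f.
Proof.
have sn := sn0 G; have gn := pre_n0 pg.
pose r := cj U (Lsl V g g).
have re : r *m e = ip e g *: g.
  by rewrite /r cjE -!mulmxA (U_e K) (Lff_e K pg) -scalemxAr (U_f K pg).
have rr : r *m r = r by rewrite /r -(cjM K) (Lff_idem K pg).
have ra : adj_op r = r by rewrite /r (cj_adj K) (Lff_adj K pg).
have rc : comm_mx (Lsl V f f) r by apply: (Sset_comm K); exact: Sset_Lsl.
apply: (mulIf gn).
have er : (ip e g)^* = ip e g by rewrite ipC -(pre_e pg).
have -> : ip (Lsl V f f *m g) (Lsl V f f *m g) * ip e g * ip e g =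
    ip (Lsl V f f *m (r *m e)) (Lsl V f f *m (r *m e)).
  by rewrite re -scalemxAr ipZl ipZr er mulrC [X in _ * X]mulrC.
rewrite ip_adjl (Lff_adj K pf) [Lsl V f f *m (Lsl V f f *m _)]mulmxA (Lff_idem K pf).
rewrite [Lsl V f f *m (r *m e)]mulmxA rc -mulmxA ip_adj ra mulmxA rr.
rewrite re (Lff_e K pf) ipZl ipZr er -(ipC f g) fg (sreal G).
by rewrite mulrC [ip e f * s]mulrC.
Qed.

Lemma pair_dist : ip (Lsl V f f *m g - ip eh g *: eh) (Lsl V f f *m g - ip eh g *: eh)
   = ip (Lsl V f f *m g) (Lsl V f f *m g) - ip eh g * ip eh g.
Proof.
have er := pre_ehR K pg.
have h : ip eh (Lsl V f f *m g) = ip eh g by rewrite ip_adj (Lff_adj K pf) (Lff_eh K pf).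
rewrite ipBr !ipBl !ipZr !ipZl er (g_eh1 G) mulr1 h -[ip (_ *m _) eh]ipC h er.
by rewrite subrr subr0.
Qed.

(** The range of [Lsl V f f] contains the unit vector eh, so the projection of g has norm at least
    <eh, g>. *)
Lemma pair_ge : s <= ip e f * ip e g.
Proof.
have gn := pre_gt0 pg.
have h1 : ip eh g * ip eh g <= ip (Lsl V f f *m g) (Lsl V f f *m g).
  by rewrite -subr_ge0 -pair_dist ip_ge0.
have := ler_wpM2r (ltW (mulr_gt0 gn gn)) h1.
rewrite mulrACA (pre_eh K pg) [X in _ <= X]mulrA pair_norm -mulrA.
by rewrite ler_pM2l // (g_s0 G).
Qed.
End Pair.
End PreDual.

Section PairTheory.
Variables (s : C) (V : 'M[C]_(n * n)) (e eh : 'cV[C]_n) (U : 'M[C]_n).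
Hypothesis K : kac s V e eh U.
Let G := k_good K.
Variables f g : 'cV[C]_n.
Hypotheses (pf : presubgroup V e f) (pg : presubgroup V e g) (fg : ip f g = s).

(** The dual inequality is s <= <eh, f> <eh, g>. Multiplying by <e, f> <e, g> makes its right side
    s^2. *)
Lemma pair_eq : ip e f * ip e g = s.
Proof.
apply/eqP; rewrite eq_le (pair_ge K pf pg fg) andbT.
have h := pair_ge (dualV_kac K) (dual_pre K pf) (dual_pre K pg) fg.
have f0 := pre_gt0 pf; have g0 := pre_gt0 pg; have s0 := g_s0 G.
have := ler_wpM2r (ltW (mulr_gt0 f0 g0)) h.
by rewrite mulrACA !(pre_eh K) // ler_pM2l.
Qed.

Lemma pair_ehf : ip eh f = ip e g.
Proof.
apply: (mulIf (pre_n0 pf)); rewrite (pre_eh K pf) mulrC.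
exact: esym pair_eq.
Qed.

(** By [pair_eq] the inequality behind [pair_ge] is an equality, so the distance computed in
    [pair_dist] vanishes. *)
Lemma pair_Lff : Lsl V f f *m g = ip eh g *: eh.
Proof.
apply/eqP; rewrite -subr_eq0; apply/eqP/ip_eq0; rewrite (pair_dist K pf pg).
have g0 := pre_n0 pg.
apply/eqP; rewrite subr_eq0; apply/eqP.
apply: (mulIf g0); apply: (mulIf g0); rewrite (pair_norm K pf pg fg).
by rewrite -[RHS]mulrA mulrACA (pre_eh K pg) -mulrA pair_eq.
Qed.
End PairTheory.
End PreSubgroup.

(** * Commutation relations *)

Section Commutation.
Variables (C : numClosedFieldType) (n : nat).
Implicit Types (u v w z : 'cV[C]_n) (A B : 'M[C]_n) (V : 'M[C]_(n * n)).
Local Notation "x *v y" := (tens x y) (at level 40, left associativity).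
Local Notation swap := (@swap C n).

Lemma swapKv (t : 'cV[C]_(n * n)) : swap *m (swap *m t) = t.
Proof. by rewrite mulmxA swapK mul1mx. Qed.
Lemma swap1v A (t : 'cV[C]_(n * n)) : swap *m (op1 A *m t) = op2 A *m (swap *m t).
Proof. by rewrite mulmxA swap1 -mulmxA. Qed.
Lemma swap2v A (t : 'cV[C]_(n * n)) : swap *m (op2 A *m t) = op1 A *m (swap *m t).
Proof. by rewrite mulmxA swap2 -mulmxA. Qed.
Lemma op12v A B (t : 'cV[C]_(n * n)) : op1 A *m (op2 B *m t) = op2 B *m (op1 A *m t).
Proof. by rewrite mulmxA op12 -mulmxA. Qed.
Lemma commv m (A B : 'M[C]_m) (t : 'cV_m) : comm_mx A B -> A *m (B *m t) = B *m (A *m t).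
Proof. by move=> h; rewrite mulmxA h -mulmxA. Qed.

Lemma comm_swap12 (M : 'M[C]_(n * n)) A :
  comm_mx (swap *m M *m swap) (op2 A) -> comm_mx M (op1 A).
Proof.
rewrite /comm_mx => h; apply: op2_ext => x y.
have := congr1 (fun N => swap *m (N *m (y *v x))) h.
by rewrite /= -!mulmxA swapKv !swap2v swapKv !swapE.
Qed.

Lemma comm_swap21 (M : 'M[C]_(n * n)) A :
  comm_mx (swap *m M *m swap) (op1 A) -> comm_mx M (op2 A).
Proof.
rewrite /comm_mx => h; apply: op2_ext => x y.
have := congr1 (fun N => swap *m (N *m (y *v x))) h.
by rewrite /= -!mulmxA swapKv !swap1v swapKv !swapE.
Qed.

Section Kac.
Variables (s : C) (V : 'M[C]_(n * n)) (e eh : 'cV[C]_n) (U : 'M[C]_n).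
Hypothesis K : kac s V e eh U.
Let G := k_good K.
Let HV := g_mu G.
Let Kd := dualV_kac K.
Local Notation cj := (cj U).
Local Notation hS := (Sset (dualV V)).

Lemma VK (t : 'cV[C]_(n * n)) : adj_op V *m (V *m t) = t.
Proof. by rewrite mulmxA (mu_l HV) mul1mx. Qed.
Lemma VKV (t : 'cV[C]_(n * n)) : V *m (adj_op V *m t) = t.
Proof. by rewrite mulmxA (mu_r HV) mul1mx. Qed.

Lemma adjV_comm1 y : hS y -> comm_mx (adj_op V) (op1 (cj y)).
Proof. by move=> hy; apply/comm_swap12/(V_comm2 Kd hy). Qed.
Lemma V_comm1 y : hS y -> comm_mx V (op1 (cj y)).
Proof.
move=> hy; rewrite -[V]adj_opK; apply: comm_unitary (adjV_comm1 hy).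
  by rewrite adj_opK (mu_r HV).
by rewrite adj_opK (mu_l HV).
Qed.

Lemma hcomul_comm2 x y : hS x -> hS y -> comm_mx (adj_op V *m op2 x *m V) (op2 (cj y)).
Proof.
move=> hx hy; have := comul_comm1 Kd hx hy; rewrite adj_dualV /dualV => h.
apply: comm_swap21; move: h; rewrite !mulmxA.
by rewrite -[_ *m swap *m op1 x]mulmxA swap1 mulmxA -[_ *m swap *m swap]mulmxA swapK mulmx1.
Qed.

Lemma hcyc z : exists2 y, hS y & y *m eh = z.
Proof. by exists (lam s (dualV V) e z); [exact: Sset_lam (k_good Kd) _ | exact: lam_e (k_good Kd) _]. Qed.

Lemma hcj_cyc z : exists2 y, hS y & cj y *m eh = z.
Proof. exact: cj_cyc Kd z. Qed.

Lemma conj_hcomul_comm2 x y : hS x -> hS y -> comm_mx (V *m op2 (cj y) *m adj_op V) (op2 x).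
Proof.
move=> hx hy; have h := hcomul_comm2 hx hy.
have h2 : adj_op V *m op2 x = adj_op V *m op2 x *m V *m adj_op V.
  by rewrite -[RHS]mulmxA (mu_r HV) mulmx1.
rewrite /comm_mx -[LHS]mulmxA h2 [LHS]mulmxA -[_ *m op2 (cj y) *m _]mulmxA.
by rewrite -h !mulmxA (mu_r HV) mul1mx.
Qed.

Lemma swap_V_eh z : V *m (eh *v (U *m z)) = swap *m (V *m (eh *v z)).
Proof.
have h1 x : Sset V x -> V *m (eh *v (x *m e)) = op1 (cj x) *m (V *m (eh *v e)).
  move=> hx; rewrite -[LHS](op1UK K) (op1U_eh K).
  rewrite -[in LHS](comul_eh K e hx) VK -(op1U_eh K) !mulmxA -!op1M.
  by rewrite cjE.
have [x hx hz] := cj_cyc K z.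
rewrite -hz -[eh *v (cj x *m e)]op2E (commv _ (V_comm2 K hx)) swap2v (swap_V_eh_e G).
rewrite -h1 // cjE -!mulmxA (UK K) (U_e K).
by [].
Qed.

(** Both sides commute with [op1 (cj y1)] and [op2 y2] for y1, y2 in the dual algebra. Since eh is
    cyclic in each leg, comparing them on eh (x) eh is enough. *)
Lemma conj_hcomulE y : hS y ->
  V *m op2 (cj y) *m adj_op V =
  swap *m op1 U *m (adj_op V *m op2 y *m V) *m op1 U *m swap.
Proof.
move=> hy; apply: op2_ext => a b.
have [y1 h1 <-] := hcj_cyc a; have [y2 h2 <-] := hcyc b.
rewrite -op1E -op2E.
have U2 (t : 'cV[C]_(n * n)) : op1 U *m (op1 y2 *m t) = op1 (cj y2) *m (op1 U *m t).
  by rewrite !mulmxA -!op1M cjE -!mulmxA (UU K) mulmx1.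
have U3 (t : 'cV[C]_(n * n)) : op1 U *m (op1 (cj y2) *m t) = op1 y2 *m (op1 U *m t).
  by rewrite !mulmxA -!op1M cjE !mulmxA (UU K) mul1mx.
have hcomulv (t : 'cV[C]_(n * n)) : adj_op V *m (op2 y *m (V *m (op2 (cj y1) *m t))) =
    op2 (cj y1) *m (adj_op V *m (op2 y *m (V *m t))).
  by have := commv t (hcomul_comm2 hy h1); rewrite -!mulmxA.
have conjv (t : 'cV[C]_(n * n)) : V *m (op2 (cj y) *m (adj_op V *m (op2 y2 *m t))) =
    op2 y2 *m (V *m (op2 (cj y) *m (adj_op V *m t))).
  by have := commv t (conj_hcomul_comm2 h2 hy); rewrite -!mulmxA.
have c1 := commv _ (V_comm1 h1); have c1' := commv _ (adjV_comm1 h1).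
have c2 := commv _ (V_comm1 h2); have c2' := commv _ (adjV_comm1 h2).
rewrite -!mulmxA c1' -(op12v (cj y1) (cj y)) c1 conjv.
rewrite (swap1v (cj y1)) (swap2v y2) (op12v U (cj y1)) U2 hcomulv c2 -(op12v (cj y2) y) c2'.
rewrite (op12v U (cj y1)) U3 (swap2v (cj y1)) (swap1v y2).
congr (op1 _ *m (op2 _ *m _)).
rewrite (cofixed_adj HV (g_cofix G)) op2E swapE op1E (U_eh K) (g_cofix G) op2E.
by rewrite -(op1U_eh K) (op1UK K) -swap_V_eh cjE -!mulmxA (U_eh K).
Qed.

(* A form of the identity (Sigma U_2 V)^3 = 1 of Baaj and Skandalis. *)
Lemma V_U_cube (t : 'cV_(n * n)) : V *m (op1 U *m (swap *m (V *m t))) =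
  op2 U *m (swap *m (adj_op V *m (op2 U *m (swap *m t)))).
Proof.
rewrite !mulmxA; congr (_ *m t); rewrite -!mulmxA.
apply: op2_ext => a b; have [y hy <-] := hcj_cyc b; rewrite -op2E -!mulmxA.
have Rv (r : 'cV[C]_(n * n)) : V *m (op2 (cj y) *m r) =
   swap *m (op1 U *m (adj_op V *m (op2 y *m (V *m (op1 U *m (swap *m (V *m r))))))).
  have := congr1 (mulmx^~ (V *m r)) (conj_hcomulE hy).
  by rewrite /= -!mulmxA VK.
rewrite Rv swapKv (op1UK K) VKV.
rewrite (swap2v (cj y)) -(op12v (cj y) U) (commv _ (adjV_comm1 hy)) (swap1v (cj y)).
have -> (r : 'cV[C]_(n * n)) : op2 U *m (op2 (cj y) *m r) = op2 y *m (op2 U *m r).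
  by rewrite !mulmxA -!op2M cjE !mulmxA (UU K) mul1mx.
congr (op2 _ *m _).
rewrite (g_cofix G) swapE op1E (U_eh K) op2E -swap1v -(op1U_eh K) (op1UK K).
by rewrite swap_V_eh swapKv.
Qed.

(** * Commutation between the coideals of a pre-subgroup *)

Section One.
Variable f : 'cV[C]_n.
Hypothesis pf : presubgroup V e f.
Let f1 : ip f f = 1. Proof. by case: pf. Qed.
Let Vff : V *m (f *v f) = f *v f. Proof. by case: pf => _ []. Qed.

(** Used to produce elements of G_f out of arbitrary slices, in [Gset_Lsl_Rff]. *)
Lemma Lsl_Rff u z : Lsl V u (Rsl V f f *m z) *m e = Rsl V f f *m (Lsl V u z *m e).
Proof.
apply: ip_ext => w; rewrite -RL -slice_mulR // (fixed_adj HV (g_fix G)) op1E.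
by rewrite -ip_adj RE.
Qed.

Lemma V_Rff z : V *m ((Rsl V f f *m z) *v e) = op2 (Rsl V f f) *m (V *m (z *v e)).
Proof.
by apply: ip2_ext => u w; rewrite -LE Lsl_Rff mulmxA -op2_Lsl LE -mulmxA.
Qed.

Lemma Gset_Lsl_Rff u z : Gset V e f (Lsl V u (Rsl V f f *m z)).
Proof.
split; first exact: Sset_Lsl.
by apply/(Rff_fixP HV f1); rewrite Lsl_Rff mulmxA (Rff_idem HV f1 Vff).
Qed.

(** Up to a scalar, y is the slice of V^* at the vector y eh of H^f, and H^f is U S U applied to f.
    By [low_adjV] the operator x passes through V^* on vectors with second leg f; the operators of U
    S U on that leg do no harm. *)
Lemma comm_G_hD x y : Gset V e f x -> Gset (dualV V) eh f y -> comm_mx x y.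
Proof.
move=> [hx hxf] [hy /(Hlow_dual _ _ HV) hyf].
have [x' hx' ex'] := Hup_cyc K pf hyf.
have h z : op1 x *m (adj_op V *m (z *v (y *m eh))) = adj_op V *m ((x *m z) *v (y *m eh)).
  rewrite -ex' -!op2E (commv _ (adjV_comm2 K hx')) op12v.
  by rewrite (low_adjV K) // (commv _ (adjV_comm2 K hx')).
have /(SsetP (k_good Kd)) -> := hy.
rewrite /lam; apply: comm_mxZ; rewrite L_dualV -Rsl_adj.
apply: op_ext => w z; rewrite -!mulmxA [LHS]ip_adj !RE -h [RHS]ip_adj.
by rewrite adj_op1E op1E.
Qed.

(** Since V (1 (x) [cj y]) V^* commutes with the dual algebra on the second leg, only z = eh
    matters, and there [cj y] yields a vector of H^f. *)
Lemma up_conj y z : hS y -> Hup V f (U *m (y *m eh)) ->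
  op2 (cj y) *m (adj_op V *m (f *v z)) = adj_op V *m (f *v (cj y *m z)).
Proof.
move=> hy h; have [y' hy' <-] := hcyc z.
have conjv (t : 'cV[C]_(n * n)) : V *m (op2 (cj y) *m (adj_op V *m (op2 y' *m t))) =
    op2 y' *m (V *m (op2 (cj y) *m (adj_op V *m t))).
  by have := commv t (conj_hcomul_comm2 hy' hy); rewrite -!mulmxA.
rewrite -[LHS]VK -op2E conjv (cofixed_adj HV (g_cofix G)) op2E.
rewrite [cj y *m eh](_ : _ = U *m (y *m eh)); last by rewrite cjE -!mulmxA (U_eh K).
rewrite h op2E; congr (_ *m (_ *v _)); rewrite mulmxA.
by rewrite [RHS]mulmxA -(Sset_comm Kd hy' hy) cjE -!mulmxA (U_eh K).
Qed.

Lemma comm_hG_L y : hS y -> Hup V f (U *m (y *m eh)) -> comm_mx (cj y) (Lsl V f f).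
Proof.
move=> hy h; rewrite -(Lff_adj K pf) -Lsl_adj; apply: op_ext => w z.
rewrite -!mulmxA [LHS]ip_adj !LE -up_conj // [RHS]ip_adj.
by rewrite adj_op2E op2E.
Qed.

(** As for [comm_G_hD], with [adj_Lsl_U] writing x as a slice of V^* at U x e. This vector of H_f
    arises from f by the conjugate of the dual algebra, which reduces the claim to [up_conj]. *)
Lemma comm_D_hG x y : Sset V x -> Hlow V f (U *m (x *m e)) ->
  hS y -> Hup V f (U *m (y *m eh)) -> comm_mx x (cj y).
Proof.
move=> hx hxf hy hyf; apply: comm_mx_sym.
have /(SsetP G) -> := hx.
rewrite /lam; apply: comm_mxZ; rewrite -(adj_Lsl_U K) -Lsl_adj.
have [y' hy' <-] := Hup_cyc Kd (dual_pre K pf) (proj2 (Hup_dual _ _ HV) hxf).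
apply: op_ext => w z; rewrite -!mulmxA [LHS]ip_adj !LE -!op1E.
rewrite !(commv _ (adjV_comm1 hy')) -up_conj // op12v [RHS]ip_adj.
by rewrite adj_op2E op2E.
Qed.

End One.
End Kac.

Lemma pair_Rff s V e eh U f g : kac s V e eh U -> presubgroup V e f -> presubgroup V e g ->
  ip f g = s -> Rsl V f f *m g = ip e g *: e.
Proof.
move=> K pf pg fg; rewrite -(dual_Rff K pf).
exact (pair_Lff (dualV_kac K) (dual_pre K pf) (dual_pre K pg) fg).
Qed.

End Commutation.

(** * The canonical unitary attached to two complementary pre-subgroups *)

Section Canonical.
Variables (C : numClosedFieldType) (n : nat).
Implicit Types (u v w z : 'cV[C]_n) (A B : 'M[C]_n) (V : 'M[C]_(n * n)).
Local Notation "x *v y" := (tens x y) (at level 40, left associativity).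
Local Notation bas := (@bas C n).
Local Notation swap := (@swap C n).

Lemma Lsl_tens A B u v : Lsl (A *t B) u v = ip u (A *m v) *: B.
Proof.
apply: op_ext => w x; rewrite LE -tens12 -mulmxA op2E op1E ip_tens.
by rewrite -scalemxAl ipZr.
Qed.

Lemma Lsl_sum I (r : seq I) (P : pred I) (F : I -> 'M[C]_(n * n)) u v :
  Lsl (\sum_(i <- r | P i) F i) u v = \sum_(i <- r | P i) Lsl (F i) u v.
Proof.
apply: op_ext => w x; rewrite LE !mulmx_suml !ip_sumr.
by apply: eq_bigr => i _; rewrite LE.
Qed.

Lemma Lsl_comb (F : 'cV[C]_n -> 'cV[C]_n -> 'M[C]_n) :
  (forall u v, F u v = \sum_a \sum_b ((u a 0)^* * v b 0) *: F (bas a) (bas b)) ->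
  exists X : 'M[C]_(n * n), forall u v, Lsl X u v = F u v.
Proof.
move=> h; exists (\sum_a \sum_b delta_mx a b *t F (bas a) (bas b)) => u v.
rewrite h Lsl_sum; apply: eq_bigr => a _; rewrite Lsl_sum; apply: eq_bigr => b _.
by rewrite Lsl_tens ip_delta.
Qed.

Section Kac.
Variables (s : C) (V : 'M[C]_(n * n)) (e eh : 'cV[C]_n) (U : 'M[C]_n).
Hypothesis K : kac s V e eh U.
Let G := k_good K.
Let HV := g_mu G.
Let Kd := dualV_kac K.
Local Notation lam := (lam s V eh).
Local Notation cj := (cj U).
Local Notation hS := (Sset (dualV V)).

Lemma lam_sum I (r : seq I) (P : pred I) (F : I -> 'cV[C]_n) :
  lam (\sum_(i <- r | P i) F i) = \sum_(i <- r | P i) lam (F i).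
Proof.
apply: (big_morph lam) => [x y|]; first exact: lamD.
by rewrite -(scale0r 0) lamZ scale0r.
Qed.

(** This forces the second leg into S by retaining only the values of the slices at e. *)
Lemma lift_ex (Z : 'M[C]_(n * n)) :
  exists X : 'M[C]_(n * n), forall u v, Lsl X u v = lam (Lsl Z u v *m e).
Proof.
apply: Lsl_comb => u v; rewrite Lsl_suml mulmx_suml lam_sum; apply: eq_bigr => a _.
rewrite Lsl_sumr scaler_sumr mulmx_suml lam_sum; apply: eq_bigr => b _.
by rewrite scalerA -scalemxAl lamZ.
Qed.

Lemma hcomul_e y z : hS y -> op2 y *m (V *m (z *v e)) = V *m ((y *m z) *v e).
Proof.
move=> hy; have := comul_eh Kd z hy; rewrite adj_dualVE -swap2v.
rewrite /dualV -!mulmxA swapKv => /(congr1 (mulmx swap)); rewrite swapKv swapE => <-.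
by rewrite (VKV K).
Qed.

Lemma S_Omega x : Sset V x -> V *m (eh *v (x *m e)) = op1 (cj x) *m (V *m (eh *v e)).
Proof.
move=> hx; rewrite -[LHS](op1UK K) (op1U_eh K).
rewrite -[in LHS](comul_eh K e hx) (VK K) -(op1U_eh K) !mulmxA -!op1M.
by rewrite cjE.
Qed.

Lemma hS_Rsl u v : hS (Rsl V u v).
Proof.
apply: (Sset_bicomm Kd) => y hy.
by have /comm_op1P := V_comm1 K hy; apply.
Qed.

Lemma conj_comul_comm1 x x' : Sset V x -> Sset V x' ->
  comm_mx (adj_op V *m op1 (cj x) *m V) (op1 x').
Proof.
move=> hx hx'; apply: comm_swap12.
have hdd x1 : Sset V x1 -> Sset (dualV (dualV V)) x1 by rewrite dualVK.
have := conj_hcomul_comm2 Kd (hdd _ hx') (hdd _ hx); rewrite adj_dualV /dualV !mulmxA.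
by rewrite -[_ *m swap *m op2 _]mulmxA swap2 mulmxA -[_ *m swap *m swap]mulmxA swapK mulmx1.
Qed.

Variables f g : 'cV[C]_n.
Hypotheses (pf : presubgroup V e f) (pg : presubgroup V e g) (fg : ip f g = s).

(* The last field says that X (x (x) 1) X^* is the coproduct of x in the coideal of f. *)
Record canon (X : 'M[C]_(n * n)) : Prop := Canon {
  x_u1 : adj_op X *m X = 1%:M;
  x_u2 : X *m adj_op X = 1%:M;
  x_L : forall u v, Gset V e f (Lsl X u v);
  x_R : forall u v, hS (Rsl X u v);
  x_Rg : forall u v, Hup V g (U *m (Rsl X u v *m eh));
  x_g : forall z, X *m (z *v g) = V *m (z *v g);
  x_f : forall z, X *m (f *v z) = V *m (f *v z);
  x_gfix : fixedv X g;
  x_ffix : cofixedv X f;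
  x_comul : forall x, Gset V e f x -> X *m op1 x = V *m op1 x *m adj_op V *m X }.

(** * Existence of the canonical unitary *)

Section Build.
Let k := (ip e g)^-1.
Let p := Rsl V f f.
Let q := Lsl V g g.
Variable X : 'M[C]_(n * n).
(** Equivalently, [X] sends z (x) e to k (1 (x) p) V (z (x) g) and commutes with right
    multiplications of S on the second leg. The constant [k] compensates p g = <e, g> e. *)
Hypothesis HX : forall u v, Lsl X u v = lam (k *: (p *m (Lsl V u v *m g))).

Let f1 : ip f f = 1. Proof. by case: pf. Qed.
Let Vff : V *m (f *v f) = f *v f. Proof. by case: pf => _ []. Qed.
Let Vgg : V *m (g *v g) = g *v g. Proof. by case: pg => _ []. Qed.
Let kn : k * ip e g = 1. Proof. by rewrite mulVf // (pre_n0 pg). Qed.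
Let qS : Sset V q. Proof. exact: Sset_Lsl. Qed.
Let pS : hS p. Proof. exact (Rff_Sset K pf). Qed.
Let pg' : p *m g = ip e g *: e. Proof. exact (pair_Rff K pf pg fg). Qed.
Let ge : k *: (q *m e) = g.
Proof. by rewrite (Lff_e K pg) scalerA kn scale1r. Qed.
Let cq_e : cj q *m e = q *m e.
Proof. by rewrite cjE -!mulmxA (U_e K) (Lff_e K pg) -scalemxAr (U_f K pg). Qed.
Let ehf : ip eh f = ip e g. Proof. exact (pair_ehf K pf pg fg). Qed.
Let p_eh : p *m eh = ip e g *: f.
Proof. by rewrite (Rff_eh K pf) ehf. Qed.
Let feh : k *: (p *m eh) = f.
Proof. by rewrite p_eh scalerA kn scale1r. Qed.
Let cp_eh : cj p *m eh = p *m eh.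
Proof. by rewrite cjE -!mulmxA (U_eh K) p_eh -scalemxAr (U_f K pf). Qed.
Let cq_f : cj q *m f = ip e g *: eh.
Proof.
have fg' : ip g f = s by rewrite -ipC fg (sreal G).
by rewrite cjE -!mulmxA (U_f K pf) (pair_Lff K pg pf fg') ehf -scalemxAr (U_eh K).
Qed.
Let ehf' : k *: (cj q *m f) = eh.
Proof. by rewrite cq_f scalerA kn scale1r. Qed.

Let Xe z : X *m (z *v e) = k *: (op2 p *m (V *m (z *v g))).
Proof.
apply: ip2_ext => u w; rewrite -LE HX (lam_e G) !ipZr; congr (_ * _).
by rewrite mulmxA -op2_Lsl LE -mulmxA.
Qed.

Let X_L u v : Gset V e f (Lsl X u v).
Proof.
rewrite HX; split; first exact: Sset_lam G _.
rewrite (lam_e G) /Hlow tensZl -scalemxAr; congr (_ *: _).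
by apply/(Rff_fixP HV f1); rewrite mulmxA (Rff_idem HV f1 Vff).
Qed.

Let Xc2 y : Sset V y -> comm_mx X (op2 (cj y)).
Proof. by move=> hy; apply/comm_op2P => u v; apply: (Sset_comm K) hy; case: (X_L u v). Qed.

Let Xcp : comm_mx X (op2 p).
Proof. by apply/comm_op2P => u v; apply: (Gset_comm K pf (X_L u v)). Qed.

Let Xc1 y : hS y -> comm_mx X (op1 (cj y)).
Proof.
move=> hy; apply: op2_ext => a b; have [y' hy' <-] := cj_cyc K b.
rewrite -!mulmxA -op2E op12v !(commv _ (Xc2 hy')) op12v; congr (_ *m _).
rewrite op1E !Xe -scalemxAr op12v; congr (_ *: (_ *m _)).
by rewrite -op1E (commv _ (V_comm1 K hy)).
Qed.

(** The same operator seen from its first leg, with f and [cj q] in place of g and [p]. [S_Omega] is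
    what carries q across the legs. *)
Let X_eh b : X *m (eh *v b) = k *: (op1 (cj q) *m (V *m (f *v b))).
Proof.
have [y hy <-] := cj_cyc K b.
rewrite -!op2E (commv _ (Xc2 hy)) (commv _ (V_comm2 K hy)) op12v scalemxAr.
congr (_ *m _); rewrite Xe; congr (_ *: _).
rewrite -[in LHS]ge -cq_e tensZr -scalemxAr -op2E (commv _ (V_comm2 K qS)).
rewrite -[in RHS]feh -cp_eh tensZl -[in RHS]scalemxAr -op1E (commv _ (V_comm1 K pS)).
rewrite -!scalemxAr; congr (_ *: _).
have -> : op2 (cj q) *m (V *m (eh *v e)) = op1 (cj q) *m (V *m (eh *v e)).
  by rewrite -(S_Omega qS) -(commv _ (V_comm2 K qS)) op2E cq_e.
rewrite -op12v; congr (_ *m _).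
by rewrite hcomul_e // -(commv _ (V_comm1 K pS)) op1E cp_eh.
Qed.

Let cqq : cj q *m cj q = cj q.
Proof. by rewrite -(cjM K) (Lff_idem K pg). Qed.

Let cqqv (t : 'cV_(n * n)) : op1 (cj q) *m (op1 (cj q) *m t) = op1 (cj q) *m t.
Proof. by rewrite mulmxA -op1M cqq. Qed.

Let X_R u v : hS (Rsl X u v).
Proof.
apply: (Sset_bicomm Kd) => y hy.
by have /comm_op1P := Xc1 hy; apply.
Qed.

Let U_cj A (z : 'cV_n) : A *m (U *m z) = U *m (cj A *m z).
Proof. by rewrite cjE -!mulmxA (UK K). Qed.

Let X_Rg u v : Hup V g (U *m (Rsl X u v *m eh)).
Proof.
apply/(Lff_fixP K pg); rewrite U_cj; congr (_ *m _).
apply: ip_ext => w; rewrite mulmxA -op1_Rsl !RE -mulmxA X_eh -scalemxAr.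
by rewrite cqqv.
Qed.

(** Right slices of [V] at a vector of H^g belong to the coideal of g in the dual, so [comm_hG_L]
    makes them commute with [cj q]. *)
Let V_q z b : op1 (cj q) *m (V *m (z *v (q *m b))) = V *m ((cj q *m z) *v (q *m b)).
Proof.
have h u v : comm_mx (Rsl V u (q *m v)) (cj q).
  have hV : V *m (eh *v (q *m v)) = op1 (cj q) *m (V *m (eh *v v)).
    have := V_Rff Kd g v; rewrite (dual_Lff K pg) !dualVE -swap1v.
    move/(congr1 (mulmx swap)); rewrite !swapKv => h.
    rewrite -[LHS](op1UK K) (op1U_eh K) h -(op1U_eh K) !mulmxA -!op1M.
    by rewrite cjE.
  apply: (comm_cjl K); apply: (comm_hG_L K pg (hS_Rsl _ _)).
  apply/(Lff_fixP K pg); rewrite U_cj; congr (_ *m _).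
  apply: ip_ext => w; rewrite mulmxA -op1_Rsl !RE -mulmxA hV.
  by rewrite cqqv.
apply: ip2_ext => u w.
rewrite mulmxA -RE op1_Rsl -h -mulmxA RE.
by [].
Qed.

Let X_g z : X *m (z *v g) = V *m (z *v g).
Proof.
have [y hy <-] := hcj_cyc K z.
rewrite -op1E (commv _ (Xc1 hy)) (commv _ (V_comm1 K hy)); congr (_ *m _).
have qg : q *m g = g by apply/(Lff_fixP K pg).
by rewrite X_eh -qg V_q cq_f qg tensZl -scalemxAr scalerA kn scale1r.
Qed.

(** With f = p f in the first leg, [V] only contributes slices in G_f. They let [p] pass to g, where
    it gives <e, g> e. *)
Let X_f z : X *m (f *v z) = V *m (f *v z).
Proof.
have [y hy <-] := cj_cyc K z.
rewrite -op2E (commv _ (Xc2 hy)) (commv _ (V_comm2 K hy)); congr (_ *m _).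
have ppf : p *m f = f by apply/(Rff_fixP HV f1).
have h : comm_mx (V *m op1 p) (op2 p).
  apply/comm_op2P => u v; rewrite Lsl_op1.
  exact (Gset_comm K pf (Gset_Lsl_Rff K pf u v)).
rewrite Xe -ppf -[_ *v g]op1E 2!mulmxA -[_ *m V *m _]mulmxA -h -!mulmxA op2E op1E pg' tensZr.
by rewrite -scalemxAr scalerA kn scale1r ppf.
Qed.

Let X_gfix : fixedv X g.
Proof.
move=> z; have [y hy <-] := cj_cyc K z.
rewrite -op2E (commv _ (Xc2 hy)); congr (_ *m _).
by rewrite Xe Vgg op2E pg' tensZr scalerA kn scale1r.
Qed.

Let X_ffix : cofixedv X f.
Proof.
move=> z; have [y hy <-] := hcj_cyc K z.
rewrite -op1E (commv _ (Xc1 hy)); congr (_ *m _).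
by rewrite X_eh Vff op1E cq_f tensZl scalerA kn scale1r.
Qed.

(** N = X^* X has the coefficients of 1 between f (x) w and z (x) g, because [X] is [V] on both. It
    commutes with [cj q] and the conjugated dual algebra on the first leg, which generate H from f,
    and with [p] and U S U on the second, which generate H from g. *)
Let X_u1 : adj_op X *m X = 1%:M.
Proof.
pose N := adj_op X *m X.
have cN (A : 'M_(n * n)) : comm_mx X A -> comm_mx X (adj_op A) -> comm_mx N A.
  move=> h1 h2; apply/comm_mx_sym; apply: comm_mxM; last exact/comm_mx_sym.
  by have := adj_comm h2; rewrite adj_opK => /comm_mx_sym.
have h0 w z z' : ip (f *v w) (N *m (z *v g)) = ip (f *v w) (z *v g).
  by rewrite /N -mulmxA -ip_adjl X_f X_g (ip_unit _ _ (mu_l HV)).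
have cq : comm_mx N (op1 (cj q)).
  have h : comm_mx X (op1 (cj q)).
    by apply/comm_op1P => u v; apply/(comm_cjl K)/(comm_hG_L K pg).
  by apply: cN => //; rewrite adj_op1E (cj_adj K) (Lff_adj K pg).
have c1 y : hS y -> comm_mx N (op1 (cj y)).
  move=> hy; apply: cN; first exact: Xc1.
  by rewrite adj_op1E (cj_adj K); apply: Xc1; exact: Sset_adj (k_good Kd) _ hy.
have c2 y : Sset V y -> comm_mx N (op2 (cj y)).
  move=> hy; apply: cN; first exact: Xc2.
  by rewrite adj_op2E (cj_adj K); apply: Xc2; exact: Sset_adj G _ hy.
have cp : comm_mx N (op2 p).
  by apply: cN => //; rewrite adj_op2E (Rff_adj HV f1 Vff).
have h1 z : N *m (z *v g) = z *v g.
  apply: ip2_ext => u w; have [y hy <-] := hcj_cyc K u.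
  rewrite -[in LHS]ehf' -[in RHS]ehf' -!scalemxAr !tensZl !ipZl; congr (_ * _).
  rewrite -!op1E [LHS]ip_adjl [RHS]ip_adjl !adj_op1E !(cj_adj K).
  have hy' := Sset_adj (k_good Kd) hy.
  rewrite -(commv _ (c1 _ hy')) [LHS]ip_adjl [RHS]ip_adjl !adj_op1E !(cj_adj K) (Lff_adj K pg).
  by rewrite -(commv _ cq) !op1E h0.
rewrite -/N; apply: op2_ext => a b; have [y hy <-] := cj_cyc K b.
rewrite mul1mx -op2E (commv _ (c2 _ hy)); congr (_ *m _).
have eg : e = k *: (p *m g) by rewrite pg' scalerA kn scale1r.
by rewrite [in LHS]eg [in RHS]eg tensZr -scalemxAr -op2E (commv _ cp) h1.
Qed.

Let X_u2 : X *m adj_op X = 1%:M.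
Proof. exact: mulmx1C. Qed.

(** The first leg of D = V^* X lies in the coideal of f in the dual. By [comm_G_hD] it commutes with
    G_f. *)
Let X_dl x : Gset V e f x -> X *m op1 x = V *m op1 x *m adj_op V *m X.
Proof.
move=> hx; pose D := adj_op V *m X.
have hD u v : Gset (dualV V) eh f (Rsl D u v).
  split.
    apply: (Sset_bicomm Kd) => y hy.
    have h : comm_mx D (op1 (cj y)).
      apply/comm_mx_sym/comm_mxM; apply/comm_mx_sym; last exact: Xc1.
      exact (adjV_comm1 K hy).
    by have /comm_op1P := h; apply.
  apply/(Hlow_dual _ _ HV)/(Lff_fixP K pf).
  apply: ip_ext => w; rewrite mulmxA -op1_Rsl !RE -mulmxA.
  (* By [X_eh] this vector is V^* ([cj q] (x) 1) V applied to f (x) b. That operator commutes with S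
     on the first leg, and f lies in the range of [Lsl V f f]. *)
  have -> b : D *m (eh *v b) = op1 (Lsl V f f) *m (D *m (eh *v b)).
    rewrite /D -!mulmxA X_eh -!scalemxAr; congr (_ *: _).
    have := commv (f *v b) (conj_comul_comm1 qS (Sset_Lsl V f f)).
    rewrite -!mulmxA op1E => <-.
    by rewrite (proj2 (Lff_fixP K pf f) Vff).
  by rewrite [op1 _ *m (op1 _ *m _)]mulmxA -op1M (Lff_idem K pf).
have cD : comm_mx D (op1 x).
  by apply/comm_op1P => u v; apply/comm_mx_sym/(comm_G_hD K pf hx).
have XD : X = V *m D by rewrite /D mulmxA (mu_r HV) mul1mx.
by rewrite -[RHS]mulmxA -/D -[RHS]mulmxA -cD mulmxA -XD.
Qed.

Lemma canon_build : canon X.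
Proof. by split. Qed.

End Build.

Lemma canon_ex : exists X, canon X.
Proof.
have [X hX] := lift_ex ((ip e g)^-1 *: (op2 (Rsl V f f) *m V *m op2 (lam g))).
exists X; apply: canon_build => u v; rewrite hX; congr (lam _).
apply: ip_ext => w; rewrite LE -scalemxAl !ipZr; congr (_ * _).
rewrite -!mulmxA op2E (lam_e G).
by rewrite ![in RHS]mulmxA -op2_Lsl LE -mulmxA.
Qed.

End Kac.
End Canonical.

(** * The multiplicative unitary *)

Section Final.
Variables (C : numClosedFieldType) (n : nat).
Implicit Types (u v w z : 'cV[C]_n) (A B : 'M[C]_n) (V : 'M[C]_(n * n)).
Local Notation "x *v y" := (tens x y) (at level 40, left associativity).
Local Notation bas := (@bas C n).
Local Notation swap := (@swap C n).

Lemma slice_r_comm V A x : (forall u v, comm_mx A (Rsl V u v)) -> hatSset V x -> comm_mx A x.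
Proof.
move=> h [om ->]; rewrite slice_rE; apply: comm_mx_sum => i _.
by apply: comm_mx_sum => j _; apply: comm_mxZ.
Qed.

Lemma Lsl_Zl V a u v : Lsl V (a *: u) v = a^* *: Lsl V u v.
Proof. by apply: op_ext => w x; rewrite -scalemxAl ipZr !LE tensZl ipZl. Qed.
Lemma Rsl_Zl V a u v : Rsl V (a *: u) v = a^* *: Rsl V u v.
Proof. by rewrite -!Lsl_dual Lsl_Zl. Qed.

Lemma lspan_sum (P : 'M[C]_n -> Prop) a (F : 'I_n -> 'M[C]_n) :
  (forall k, P (F k)) -> lspan P (a *: \sum_k F k).
Proof.
move=> h; exists [seq (a, F k) | k <- index_enum 'I_n]; split.
  by move=> p /mapP [k _ ->]; apply: h.
by rewrite big_map scaler_sumr.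
Qed.

Lemma lspan_comm (P : 'M[C]_n -> Prop) A x :
  (forall y, P y -> comm_mx A y) -> lspan P x -> comm_mx A x.
Proof.
move=> h [l [hl ->]]; rewrite big_seq; apply: comm_mx_sum => p /hl hp.
by apply: comm_mxZ; apply: h.
Qed.

Lemma comm_conj m (Y M N : 'M[C]_m) : Y *m adj_op Y = 1%:M ->
  comm_mx M (adj_op Y *m N *m Y) -> comm_mx (Y *m M *m adj_op Y) N.
Proof.
move=> hY h; have := congr1 (fun A : 'M_m => Y *m A *m adj_op Y) h.
rewrite /= !mulmxA hY mul1mx /comm_mx !mulmxA => <-.
by rewrite -[RHS]mulmxA hY mulmx1.
Qed.

Section Kac.
Variables (s : C) (V : 'M[C]_(n * n)) (e eh : 'cV[C]_n) (U : 'M[C]_n).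
Hypothesis K : kac s V e eh U.
Let G := k_good K.
Let HV := g_mu G.
Let Kd := dualV_kac K.
Local Notation cj := (cj U).
Local Notation hS := (Sset (dualV V)).

(** Left slices of [dualV V] are adjoints of right slices of [V], so the two spaces agree because S
    of the dual is closed under adjoints. *)
Lemma hatSsetP y : hatSset V y <-> hS y.
Proof.
split=> hy.
  apply: (Sset_bicomm Kd) => y' hy'; apply/comm_mx_sym/(slice_r_comm _ hy) => u v.
  by apply/comm_mx_sym; have /comm_op1P := V_comm1 K hy'; apply.
have /(SsetP (k_good Kd)) h := Sset_adj (k_good Kd) hy.
rewrite -[y]adj_opK h /lam L_dualV adj_opZ adj_opK -Rsl_Zl.
exact: hatSset_Rsl.
Qed.

Lemma hatDsetP f y : hatDset V eh f y <-> Gset (dualV V) eh f y.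
Proof.
split=> -[/hatSsetP h1 h2]; split=> //; first exact/(Hlow_dual _ _ HV).
exact/(Hlow_dual _ _ HV).
Qed.

Definition Dg g x := Sset V x /\ Hlow V g (U *m (x *m e)).
Definition hDg g y := hS y /\ Hup V g (U *m (y *m eh)).

Lemma DsetP g x : Dset V e U g x <-> Dg g x.
Proof.
split=> -[h1 h2]; split=> //.
  by case: h2 => eta [h2 ->]; rewrite (UK K).
by exists (U *m (x *m e)); rewrite (UK K).
Qed.

Lemma hatGsetP g y : hatGset V eh U g y <-> hDg g y.
Proof.
split=> -[/hatSsetP h1 h2]; split=> //.
  by case: h2 => eta [h2 ->]; rewrite (UK K).
by exists (U *m (y *m eh)); rewrite (UK K).
Qed.

Lemma hDg_adj g y : presubgroup V e g -> hDg g y -> hDg g (adj_op y).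
Proof.
move=> pg [hy h]; split; first exact: Sset_adj (k_good Kd) _ hy.
have := adj_comm (comm_hG_L K pg hy h); rewrite (Lff_adj K pg) (cj_adj K) => hc.
apply/(Lff_fixP K pg).
have -> : U *m (adj_op y *m eh) = cj (adj_op y) *m eh by rewrite cjE -!mulmxA (U_eh K).
by rewrite mulmxA -hc -mulmxA (Lff_eh K pg).
Qed.

End Kac.

Section Pair.
Variables (s : C) (V : 'M[C]_(n * n)) (e eh : 'cV[C]_n) (U : 'M[C]_n).
Hypothesis K : kac s V e eh U.
Let G := k_good K.
Let HV := g_mu G.
Let Kd := dualV_kac K.
Local Notation cj := (cj U).
Local Notation hS := (Sset (dualV V)).

Lemma Dg_dual g x : Dg V e U g x <-> hDg (dualV V) e U g x.
Proof. by rewrite /Dg /hDg dualVK; split=> -[h1 h2]; split=> //; exact/(Hup_dual _ _ HV). Qed.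

Lemma Dg_adj g x : presubgroup V e g -> Dg V e U g x -> Dg V e U g (adj_op x).
Proof. by move=> pg /Dg_dual h; apply/Dg_dual/(hDg_adj Kd (dual_pre K pg) h). Qed.

Variables f g : 'cV[C]_n.
Hypotheses (pf : presubgroup V e f) (pg : presubgroup V e g) (fg : ip f g = s).
Let g1 : ip g g = 1. Proof. by case: pg. Qed.
Variables X X' : 'M[C]_(n * n).
Hypotheses (hX : canon V e eh U f g X) (hX' : canon (dualV V) eh e U f g X').

Local Notation Gf := (Gset V e f).
Local Notation hGf := (Gset (dualV V) eh f).

(** The legs of the factor built from [X'] lie in D_g and in the conjugate by [U] of the dual
    coideal of f; those of [X] lie in the dual coideal of g and in G_f. Slices of the product are
    thus sums of the generators of A and B. The lock keeps rewriting from unfolding it. *)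
Definition bicrossed := locked (op2 U *m adj_op X' *m op2 U *m X).
Local Notation W := bicrossed.
Let Y := op2 U *m adj_op X' *m op2 U.
Let WE : W = Y *m X. Proof. by rewrite /bicrossed -lock. Qed.

Let aop2U : adj_op (op2 U) = op2 U. Proof. by rewrite adj_op2E (adjU K). Qed.
Let U2 : op2 U *m op2 U = 1%:M. Proof. by rewrite -op2M (UU K) op2_1. Qed.

Let aY : adj_op Y = op2 U *m X' *m op2 U.
Proof. by rewrite /Y !adj_opM adj_opK aop2U mulmxA. Qed.

Let Y1 : adj_op Y *m Y = 1%:M.
Proof.
rewrite aY /Y !mulmxA -[_ *m op2 U *m op2 U]mulmxA U2 mulmx1.
by rewrite -[_ *m X' *m _]mulmxA (x_u2 hX') mulmx1 U2.
Qed.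
Let Y2 : Y *m adj_op Y = 1%:M. Proof. exact: mulmx1C. Qed.

Lemma W_u1 : adj_op W *m W = 1%:M.
Proof.
rewrite WE adj_opM mulmxA -[_ *m adj_op Y *m Y]mulmxA Y1 mulmx1.
exact: x_u1 hX.
Qed.
Lemma W_u2 : W *m adj_op W = 1%:M. Proof. exact: mulmx1C W_u1. Qed.

Lemma W_fix : fixedv W g.
Proof.
move=> z; rewrite WE -mulmxA (x_gfix hX) /Y -!mulmxA op2E.
by rewrite (adj_fix (x_u1 hX') (x_gfix hX' _)) op2E (UK K).
Qed.
Lemma W_cofix : cofixedv W f.
Proof.
move=> z; rewrite WE -mulmxA (x_ffix hX) /Y -!mulmxA op2E (U_f K pf).
by rewrite (adj_fix (x_u1 hX') (x_ffix hX' _)) op2E (U_f K pf).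
Qed.

(** On g the factor [X] becomes [V], and on f the factor [X'] becomes the dual of [V]. [V_U_cube]
    reduces what is left to <V (f (x) U w), g (x) U z>; replacing [V] by [X] again, which fixes g
    (x) U z, leaves <f, g> <w, z>. *)
Lemma W_cyc z : Lsl W f z *m g = s *: z.
Proof.
have ipS (a b : 'cV[C]_(n * n)) : ip (swap *m a) b = ip a (swap *m b).
  by rewrite ip_adjl adj_swap.
have ip1U (a b : 'cV[C]_(n * n)) : ip (op1 U *m a) b = ip a (op1 U *m b).
  by rewrite ip_adjl adj_op1E (adjU K).
have ip2U (a b : 'cV[C]_(n * n)) : ip a (op2 U *m b) = ip (op2 U *m a) b.
  by rewrite ip_adj aop2U.
apply: ip_ext => w; rewrite LE WE -mulmxA (x_g hX).
rewrite ip_adj aY -!mulmxA op2E (x_f hX') dualVE -swap1v ipS ip1U -ip_adj (V_U_cube K).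
rewrite swapE op2E ip2U op2E (U_f K pf) -ipS swapE -ip_adjl -(x_f hX) ip_adjl.
by rewrite (adj_fix (x_u1 hX) (x_gfix hX _)) ip_tens fg (ipU K) (UK K) ipZr.
Qed.

Lemma W_cycR u : adj_op (Rsl W u g) *m f = s *: u.
Proof.
apply: ip_ext => w; rewrite -ip_adjl -ipC RL W_cyc ipZr rmorphM /= (sreal G) ipC.
by rewrite ipZr.
Qed.

Lemma Lsl_Y u k : Lsl Y u k = cj (adj_op (Lsl X' k u)).
Proof. by rewrite /Y Lsl_op2 op2_Lsl Lsl_adj cjE. Qed.
Lemma Rsl_Y u k : Rsl Y u k = adj_op (Rsl X' (U *m k) (U *m u)).
Proof. by rewrite /Y Rsl_op2 op2_Rsl Rsl_adj (adjU K). Qed.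

Lemma Rsl_X'_Dg u v : Dg V e U g (Rsl X' u v).
Proof. by apply/Dg_dual; split; [exact: (x_R hX') | exact: (x_Rg hX')]. Qed.
Lemma Rsl_X_hDg u v : hDg V eh U g (Rsl X u v).
Proof. by split; [exact: (x_R hX) | exact: (x_Rg hX)]. Qed.

Lemma Lsl_W u v : exists y x : 'I_n -> 'M[C]_n,
  [/\ forall k, hGf (y k), forall k, Gf (x k) & Lsl W u v = \sum_k cj (y k) *m x k].
Proof.
exists (fun k => adj_op (Lsl X' (bas k) u)), (fun k => Lsl X (bas k) v); split=> [k|k|].
- exact (Gset_adj Kd (dual_pre K pf) (x_L hX' _ _)).
- exact: (x_L hX).
- by rewrite WE LslM; apply: eq_bigr => k _; rewrite Lsl_Y.
Qed.

Lemma Rsl_W u v : exists x y : 'I_n -> 'M[C]_n,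
  [/\ forall k, Dg V e U g (x k), forall k, hDg V eh U g (y k) &
      Rsl W u v = \sum_k x k *m y k].
Proof.
exists (fun k => adj_op (Rsl X' (U *m bas k) (U *m u))), (fun k => Rsl X (bas k) v).
split=> [k|k|].
- exact (Dg_adj pg (Rsl_X'_Dg _ _)).
- exact: Rsl_X_hDg.
- by rewrite WE RslM; apply: eq_bigr => k _; rewrite Rsl_Y.
Qed.

(* The commutant of [Aff] is its conjugate by [U], and similarly for [Bgg]. *)
Definition comA (Z : 'M[C]_n) := (forall y, hGf y -> comm_mx Z y) /\ (forall x, Gf x -> comm_mx Z (cj x)).
Definition comB (Z : 'M[C]_n) := (forall x, Dg V e U g x -> comm_mx Z (cj x)) /\
  (forall y, hDg V eh U g y -> comm_mx Z (cj y)).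

Lemma comA_gen x y : hGf y -> Gf x -> comA (cj y *m x).
Proof.
move=> hy hx; split=> [y' hy'|x' hx'].
  apply/comm_mx_sym/comm_mxM; last by apply/comm_mx_sym/(comm_G_hD K pf).
  by apply: (Sset_comm Kd); [case: hy' | case: hy].
apply/comm_mx_sym/comm_mxM; last by apply/comm_mx_sym/(Sset_comm K); [case: hx | case: hx'].
by apply: (comm_cj K); apply: (comm_G_hD K pf).
Qed.

Lemma comB_gen x y : Dg V e U g x -> hDg V eh U g y -> comB (x *m y).
Proof.
move=> [hx hx2] [hy hy2]; split=> [x' [hx' hx2']|y' [hy' hy2']].
  apply/comm_mx_sym/comm_mxM; first by apply/comm_mx_sym/(Sset_comm K).
  by apply/(comm_cjr K)/(comm_D_hG K pg).
apply/comm_mx_sym/comm_mxM; first by apply/comm_mx_sym/(comm_D_hG K pg).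
by apply/comm_mx_sym/(Sset_comm Kd).
Qed.

Lemma comA_Lsl u v : comA (Lsl W u v).
Proof.
have [y [x [hy hx ->]]] := Lsl_W u v.
by split=> t ht; apply/comm_mx_sym/comm_mx_sum => k _; apply/comm_mx_sym;
   have [h1 h2] := comA_gen (hy k) (hx k); [apply: h1 | apply: h2].
Qed.

Lemma comB_Rsl u v : comB (Rsl W u v).
Proof.
have [x [y [hx hy ->]]] := Rsl_W u v.
by split=> t ht; apply/comm_mx_sym/comm_mx_sum => k _; apply/comm_mx_sym;
   have [h1 h2] := comB_gen (hx k) (hy k); [apply: h1 | apply: h2].
Qed.

Lemma cj_sum (F : 'I_n -> 'M[C]_n) : cj (\sum_k F k) = \sum_k cj (F k).
Proof.
rewrite cjE mulmx_sumr mulmx_suml; apply: eq_bigr => k _.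
by rewrite cjE.
Qed.

(* [ph] is the identity, [op1] or [op2]. *)
Lemma comm_cj_Lsl m (ph : 'M[C]_n -> 'M[C]_m) (M : 'M[C]_m) u v :
  (forall A B, ph (A *m B) = ph A *m ph B) ->
  (forall F : 'I_n -> 'M[C]_n, ph (\sum_k F k) = \sum_k ph (F k)) ->
  (forall y, hGf y -> comm_mx M (ph y)) -> (forall x, Gf x -> comm_mx M (ph (cj x))) ->
  comm_mx M (ph (cj (Lsl W u v))).
Proof.
move=> phM phS h1 h2; have [y [x [hy hx ->]]] := Lsl_W u v.
rewrite cj_sum phS; apply: comm_mx_sum => k _.
by rewrite (cjM K) (cjK K) phM; apply: comm_mxM; [apply: h1 | apply: h2].
Qed.

Lemma comm_cj_Rsl m (ph : 'M[C]_n -> 'M[C]_m) (M : 'M[C]_m) u v :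
  (forall A B, ph (A *m B) = ph A *m ph B) ->
  (forall F : 'I_n -> 'M[C]_n, ph (\sum_k F k) = \sum_k ph (F k)) ->
  (forall x, Dg V e U g x -> comm_mx M (ph (cj x))) ->
  (forall y, hDg V eh U g y -> comm_mx M (ph (cj y))) ->
  comm_mx M (ph (cj (Rsl W u v))).
Proof.
move=> phM phS h1 h2; have [x [y [hx hy ->]]] := Rsl_W u v.
rewrite cj_sum phS; apply: comm_mx_sum => k _.
by rewrite (cjM K) phM; apply: comm_mxM; [apply: h1 | apply: h2].
Qed.

Lemma cj_Lsl_cyc z : cj (Lsl W f (s^-1 *: (U *m z))) *m g = z.
Proof.
rewrite cjE -!mulmxA (U_f K pg) W_cyc scalerA mulfV ?(sn0 G) // scale1r.
exact: (UK K).
Qed.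

Lemma cj_Rsl_cyc u : adj_op (cj (Rsl W (s^-1 *: (U *m u)) g)) *m f = u.
Proof.
rewrite (cj_adj K) cjE -!mulmxA (U_f K pf) W_cycR scalerA mulfV ?(sn0 G) // scale1r.
exact: (UK K).
Qed.

Lemma comA_eq Z1 Z2 : comA Z1 -> comA Z2 -> Z1 *m g = Z2 *m g -> Z1 = Z2.
Proof.
move=> [h1 h1'] [h2 h2'] h; apply: mx_ext => z; rewrite -(cj_Lsl_cyc z).
rewrite (commv _ (@comm_cj_Lsl _ id Z1 _ _ _ _ h1 h1')) // h.
by rewrite (commv _ (@comm_cj_Lsl _ id Z2 _ _ _ _ h2 h2')).
Qed.

Lemma comB_eq Z1 Z2 : comB Z1 -> comB Z2 -> adj_op Z1 *m f = adj_op Z2 *m f -> Z1 = Z2.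
Proof.
move=> [h1 h1'] [h2 h2'] h; rewrite -[Z1]adj_opK -[Z2]adj_opK; congr (adj_op _).
apply: mx_ext => z; rewrite -(cj_Rsl_cyc z).
rewrite (commv _ (adj_comm (@comm_cj_Rsl _ id Z1 _ _ _ _ h1 h1'))) // h.
by rewrite (commv _ (adj_comm (@comm_cj_Rsl _ id Z2 _ _ _ _ h2 h2'))).
Qed.

Lemma comA_Z a Z : comA Z -> comA (a *: Z).
Proof. by case=> h1 h2; split=> t ht; apply/comm_mx_sym/comm_mxZ/comm_mx_sym; [apply: h1|apply: h2]. Qed.
Lemma comB_Z a Z : comB Z -> comB (a *: Z).
Proof. by case=> h1 h2; split=> t ht; apply/comm_mx_sym/comm_mxZ/comm_mx_sym; [apply: h1|apply: h2]. Qed.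

(** This puts the whole commutant inside the slices of [W], the nontrivial inclusion for both [AffP]
    and [Sset_WP]. *)
Lemma comA_LslE Z : comA Z -> Z = s^-1 *: Lsl W f (Z *m g).
Proof.
move=> h; apply: comA_eq => //; first exact/comA_Z/comA_Lsl.
by rewrite -scalemxAl W_cyc scalerA mulVf ?scale1r // (sn0 G).
Qed.

Lemma comB_RslE Z : comB Z -> Z = s^-1 *: Rsl W (adj_op Z *m f) g.
Proof.
move=> h; apply: comB_eq => //; first exact/comB_Z/comB_Rsl.
by rewrite adj_opZ (ssV G) -scalemxAl W_cycR scalerA mulVf ?scale1r // (sn0 G).
Qed.

Lemma AffP Z : Aff V e eh U f Z <-> comA Z.
Proof.
split=> h.
  have hg (t : 'M[C]_n) : (exists x y, (exists y', hatDset V eh f y' /\ x = U *m y' *m U) /\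
      Gset V e f y /\ t = x *m y) -> comA t.
    move=> [x [y [[y' [/(hatDsetP K) h1 ->]] [h2 ->]]]].
    by rewrite -cjE; apply: comA_gen.
  by split=> t ht; apply/comm_mx_sym/(lspan_comm _ h) => z /hg [h1 h2]; apply/comm_mx_sym;
     [apply: h1 | apply: h2].
have [y [x [hy hx hE]]] := Lsl_W f (Z *m g).
rewrite (comA_LslE h) hE; apply: lspan_sum => k.
exists (cj (y k)), (x k); split; last by split.
by exists (y k); rewrite cjE; split=> //; apply/(hatDsetP K).
Qed.

Lemma BggP Z : Bgg V e eh U g Z <-> comB Z.
Proof.
split=> h.
  have hg (t : 'M[C]_n) : (exists x y, Dset V e U g x /\ hatGset V eh U g y /\ t = x *m y) -> comB t.
    by move=> [x [y [/(DsetP K) h1 [/(hatGsetP K) h2 ->]]]]; apply: comB_gen.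
  by split=> t ht; apply/comm_mx_sym/(lspan_comm _ h) => z /hg [h1 h2]; apply/comm_mx_sym;
     [apply: h1 | apply: h2].
have [x [y [hx hy hE]]] := Rsl_W (adj_op Z *m f) g.
rewrite (comB_RslE h) hE; apply: lspan_sum => k.
by exists (x k), (y k); split; [apply/(DsetP K) | split=> //; apply/(hatGsetP K)].
Qed.

Lemma commutant_subalg (P : 'M[C]_n -> Prop) :
  (forall c, P c -> P (adj_op c)) ->
  unital_star_subalg (fun Z => forall c, P c -> comm_mx Z c).
Proof.
move=> hP; split=> [c _|x y hx hy c hc|a x hx c hc|x y hx hy c hc|x hx c hc].
- exact: comm1mx.
- by apply/comm_mx_sym/comm_mxD; apply/comm_mx_sym; [apply: hx | apply: hy].
- by apply/comm_mx_sym/comm_mxZ/comm_mx_sym/hx.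
- by apply/comm_mx_sym/comm_mxM; apply/comm_mx_sym; [apply: hx | apply: hy].
- by rewrite -[c]adj_opK; apply/adj_comm/hx/hP.
Qed.

Lemma subalg_iff (P Q : 'M[C]_n -> Prop) : (forall x, P x <-> Q x) ->
  unital_star_subalg Q -> unital_star_subalg P.
Proof.
move=> h [q1 q2 q3 q4 q5]; split; first exact/h.
- by move=> x y /h hx /h hy; apply/h/q2.
- by move=> c x /h hx; apply/h/q3.
- by move=> x y /h hx /h hy; apply/h/q4.
- by move=> x /h hx; apply/h/q5.
Qed.

Lemma Aff_subalg : unital_star_subalg (Aff V e eh U f).
Proof.
pose P c := hGf c \/ exists2 x, Gf x & c = cj x.
apply: (@subalg_iff _ (fun Z => forall c, P c -> comm_mx Z c)).
  move=> Z; split=> [/AffP [h1 h2] c [|[x hx ->]]|h]; [exact: h1 | exact: h2 |].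
  by apply/AffP; split=> [y hy|x hx]; apply: h; [left | right; exists x].
apply: commutant_subalg => c [hc|[x hx ->]].
  by left; apply: (Gset_adj Kd (dual_pre K pf)).
by right; exists (adj_op x); rewrite ?(cj_adj K) //; apply: (Gset_adj K pf).
Qed.

Lemma Bgg_subalg : unital_star_subalg (Bgg V e eh U g).
Proof.
pose P c := (exists2 x, Dg V e U g x & c = cj x) \/ (exists2 y, hDg V eh U g y & c = cj y).
apply: (@subalg_iff _ (fun Z => forall c, P c -> comm_mx Z c)).
  move=> Z; split=> [/BggP [h1 h2] c [[x hx ->]|[x hx ->]]|h]; [exact: h1 | exact: h2 |].
  by apply/BggP; split=> x hx; apply: h; [left | right]; exists x.
apply: commutant_subalg => c [[x hx ->]|[x hx ->]]; [left|right].
  by exists (adj_op x); rewrite ?(cj_adj K) //; apply: Dg_adj.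
by exists (adj_op x); rewrite ?(cj_adj K) //; apply: (hDg_adj K).
Qed.

(** [x_comul] for [X'] expresses the left side by the coproduct of the dual, and [conj_hcomulE]
    rewrites that in terms of [V]. *)
Let Y_conj y : hGf y ->
  adj_op Y *m op1 y *m Y = V *m op2 (cj y) *m adj_op V.
Proof.
move=> hy; rewrite (conj_hcomulE K); last by case: hy.
have h : X' *m op1 y *m adj_op X' = dualV V *m op1 y *m adj_op (dualV V).
  by rewrite (x_comul hX' hy) -mulmxA (x_u2 hX') mulmx1.
rewrite aY /Y; apply: op2_ext => a b; rewrite -!mulmxA (op2E U).
rewrite -(op12v y U) [op2 U *m (op2 U *m _)]mulmxA U2 mul1mx.
have := congr1 (mulmx^~ (a *v (U *m b))) h; rewrite /= -!mulmxA => ->.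
rewrite adj_dualV /dualV -!mulmxA !swapE op1E swap1v swapKv.
by rewrite swap1v.
Qed.

(** Conjugating by Y^* compares X (a (x) 1) X^* with Y^* (c (x) 1) Y. Each of them is either
    unchanged or a conjugate by [V], so the four cases become known commutations in which [W] no
    longer appears. *)
Lemma W_leg1 a c : (hGf c \/ exists2 x, Gf x & c = cj x) ->
  (Gf a \/ exists2 y, hGf y & a = cj y) -> comm_mx (W *m op1 a *m adj_op W) (op1 c).
Proof.
move=> hc ha.
suff h : comm_mx (X *m op1 a *m adj_op X) (adj_op Y *m op1 c *m Y).
  rewrite (_ : W *m op1 a *m adj_op W = Y *m (X *m op1 a *m adj_op X) *m adj_op Y).
    exact (comm_conj Y2 h).
  by rewrite WE adj_opM !mulmxA.
have hYc x : Gf x -> adj_op Y *m op1 (cj x) *m Y = op1 (cj x).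
  move=> [hx _]; have h : comm_mx Y (op1 (cj x)).
    apply/comm_op1P => u v; rewrite Rsl_Y; apply: (Sset_comm K) => //.
    by apply: (Sset_adj G); case: (Rsl_X'_Dg (U *m v) (U *m u)).
  by rewrite -mulmxA -h mulmxA Y1 mul1mx.
have hXa y : hGf y -> X *m op1 (cj y) *m adj_op X = op1 (cj y).
  move=> [hy _]; have h : comm_mx X (op1 (cj y)).
    by apply/comm_op1P => u v; apply: (Sset_comm Kd) hy; exact: (x_R hX).
  by rewrite h -mulmxA (x_u2 hX) mulmx1.
have hXx x : Gf x -> X *m op1 x *m adj_op X = V *m op1 x *m adj_op V.
  by move=> hx; rewrite (x_comul hX hx) -mulmxA (x_u2 hX) mulmx1.
case: ha => [ha|[y hy ->]]; case: hc => [hc|[x hx ->]].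
- rewrite hXx // Y_conj // /comm_mx !mulmxA.
  rewrite -[_ *m adj_op V *m V]mulmxA (mu_l HV) mulmx1.
  rewrite -[_ *m adj_op V *m V in RHS]mulmxA (mu_l HV) mulmx1.
  by rewrite -[V *m op1 a *m _]mulmxA op12 mulmxA.
- rewrite hXx // hYc //.
  by apply: (comul_comm1 K); [case: ha | case: hx].
- rewrite hXa // Y_conj //; apply/comm_mx_sym.
  have hV := V_comm1 K (proj1 hy); have hV' := adjV_comm1 K (proj1 hy).
  apply/comm_mx_sym/comm_mxM; last exact/comm_mx_sym.
  by apply: comm_mxM; [exact/comm_mx_sym | exact: op12].
- rewrite hXa // hYc // /comm_mx -!op1M; congr op1.
  by apply/comm_mx_sym/(comm_cj K)/(comm_G_hD K pf).
Qed.

Lemma W_comm2 c : (hGf c \/ exists2 x, Gf x & c = cj x) -> comm_mx W (op2 c).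
Proof.
move=> hc; apply/comm_op2P => u v; have [h1 h2] := comA_Lsl u v.
by case: hc => [|[x hx ->]]; [exact: h1 | exact: h2].
Qed.


Lemma comm_Rsl_W (M : 'M[C]_(n * n)) u v : (forall u v, comB (Rsl M u v)) ->
  comm_mx M (op1 (cj (Rsl W u v))).
Proof.
move=> hM; apply/comm_op1P => u' v'; have [h1 h2] := hM u' v'.
exact: (@comm_cj_Rsl _ id).
Qed.

(* [W] intertwines the right multiplications by [B], so that its first leg is determined by [f]. *)
Lemma Lsl_first M u v : (forall u v, comB (Rsl M u v)) ->
  Lsl M u v = Lsl M f (cj (Rsl W (s^-1 *: (U *m u)) g) *m v).
Proof.
by move=> hM; rewrite -{1}(cj_Rsl_cyc u) -op1_Lsl -(comm_Rsl_W _ _ hM) Lsl_op1.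
Qed.

Lemma W_pentL : pentL W.
Proof.
move=> u v.
pose CA c := hGf c \/ exists2 x, Gf x & c = cj x.
pose L := W *m op1 (Lsl W u v) *m adj_op W.
pose R := \sum_k op1 (Lsl W u (bas k)) *m op2 (Lsl W (bas k) v).
have cL c u' v' : CA c -> comm_mx (Lsl W u' v') c.
  by have [h1 h2] := comA_Lsl u' v'; case=> [|[x hx ->]]; [exact: h1 | exact: h2].
have L1 c : CA c -> comm_mx L (op1 c).
  move=> hc; have [y [x [hy hx hE]]] := Lsl_W u v.
  have -> : L = \sum_k (W *m op1 (cj (y k)) *m adj_op W) *m (W *m op1 (x k) *m adj_op W).
    rewrite /L hE op1_sum mulmx_sumr mulmx_suml; apply: eq_bigr => k _.
    by rewrite op1M !mulmxA -[_ *m adj_op W *m W]mulmxA W_u1 mulmx1.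
  apply/comm_mx_sym/comm_mx_sum => k _.
  by apply: comm_mxM; apply/comm_mx_sym/W_leg1 => //; [right; exists (y k) | left].
have L2 c : CA c -> comm_mx L (op2 c).
  move=> hc; have h := W_comm2 hc.
  apply/comm_mx_sym/comm_mxM; last exact/comm_mx_sym/(comm_unitary W_u1 W_u2).
  by apply: comm_mxM; [exact/comm_mx_sym | exact/comm_mx_sym/op12].
have R1 c : CA c -> comm_mx R (op1 c).
  move=> hc; apply/comm_mx_sym/comm_mx_sum => k _; apply: comm_mxM; last exact: op12.
  by rewrite /comm_mx -!op1M (cL c).
have R2 c : CA c -> comm_mx R (op2 c).
  move=> hc; apply/comm_mx_sym/comm_mx_sum => k _; apply: comm_mxM.
    exact/comm_mx_sym/op12.
  by rewrite /comm_mx -!op2M (cL c).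
(* On g, every slice with left vector u is s c for one operator c, and [W] commutes with c (x) 1.
   Both sides are therefore s (c (x) 1) W (v (x) g). *)
have LR : L *m (g *v g) = R *m (g *v g).
  set c := cj (Rsl W (s^-1 *: (U *m u)) g).
  have Lg w : Lsl W u w *m g = s *: (c *m w).
    by rewrite (Lsl_first _ _ comB_Rsl) W_cyc.
  rewrite /L -!mulmxA (adj_fix W_u1 (W_fix g)) op1E Lg /R mulmx_suml.
  under eq_bigr do rewrite -mulmxA op2E op1E Lg tensZl -op1E.
  rewrite -scaler_sumr -mulmx_sumr -expL tensZl -scalemxAr; congr (_ *: _).
  by rewrite -op1E (commv _ (comm_Rsl_W _ _ comB_Rsl)).
have ext : L = R.
  have c1 M z : (forall c, CA c -> comm_mx M (op1 c)) -> comm_mx M (op1 (cj (Lsl W f z))).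
    move=> hM; apply: comm_cj_Lsl; [exact: op1M | by move=> F; exact: op1_sum | | ].
      by move=> y hy; apply: hM; left.
    by move=> x hx; apply: hM; right; exists x.
  have c2 M z : (forall c, CA c -> comm_mx M (op2 c)) -> comm_mx M (op2 (cj (Lsl W f z))).
    move=> hM; apply: comm_cj_Lsl; [exact: op2M | by move=> F; exact: op2_sum | | ].
      by move=> y hy; apply: hM; left.
    by move=> x hx; apply: hM; right; exists x.
  apply: op2_ext => a b; rewrite -(cj_Lsl_cyc a) -(cj_Lsl_cyc b) -op1E -op2E.
  rewrite (commv _ (c1 L _ L1)) (commv _ (c1 R _ R1)).
  by rewrite (commv _ (c2 L _ L2)) (commv _ (c2 R _ R2)) LR.
by rewrite -/R -ext /L -mulmxA W_u1 mulmx1.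
Qed.

Lemma W_unique W2 : munit W2 -> fixedv W2 g -> cofixedv W2 f ->
  (forall x, comA x -> Sset W2 x) -> (forall u v, comB (Rsl W2 u v)) -> W2 = W.
Proof.
move=> h2 hg hf hA hB.
have cP b u v : comm_mx (Lsl W2 u v) (Psl W2 f b).
  apply: mx_ext => z; rewrite -!mulmxA !PslE mulmxA.
  by rewrite (Lsl_cofixed_mul h2 _ _ _ hf).
(* The element s^-1 [Lsl W f z] maps g to z and belongs to S of [W2], hence commutes with
   [Psl W2 f b]. As that operator maps g to s b, evaluating at g identifies the two slices. *)
have hf2 z : Lsl W2 f z = Lsl W f z.
  have hx := hA _ (comA_Z s^-1 (comA_Lsl f z)).
  apply: mx_ext => b.
  have /(congr1 (mulmx^~ g)) := slice_l_comm (fun u v => comm_mx_sym (cP b u v)) hx.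
  rewrite /= -!mulmxA !PslE (fixed_Lslr _ hg) fg mul_scalar_mx -!scalemxAl W_cyc.
  by rewrite scalerA -scalemxAr !scalerA mulVf ?(sn0 G) // !scale1r.
apply: op_extL => u v; rewrite (Lsl_first u v hB) hf2.
by rewrite -(Lsl_first u v comB_Rsl).
Qed.

Lemma Sset_WP x : Sset W x <-> comA x.
Proof.
split=> h.
  by split=> t ht; apply/comm_mx_sym/(slice_l_comm _ h) => u v; apply/comm_mx_sym;
     have [h1 h2] := comA_Lsl u v; [apply: h1 | apply: h2].
by rewrite (comA_LslE h) -(ssV G) -Lsl_Zl; exact: Sset_Lsl.
Qed.

Lemma hatSset_WP y : hatSset W y <-> comB y.
Proof.
split=> h.
  by split=> t ht; apply/comm_mx_sym/(slice_r_comm _ h) => u v; apply/comm_mx_sym;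
     have [h1 h2] := comB_Rsl u v; [apply: h1 | apply: h2].
by rewrite (comB_RslE h) -(ssV G) -Rsl_Zl; exact: hatSset_Rsl.
Qed.

Lemma W_mult1 : multiplicity1 W.
Proof.
exists g; split; first by apply/eqP => g0; move: (g1) (oner_neq0 C); rewrite g0 ip0r => ->; rewrite eqxx.
move=> z; split=> [h|[c ->] x]; last by rewrite tensZl -scalemxAr W_fix.
exists (s^-1 * ip f z); have := W_cyc z.
rewrite (fixed_Lslr _ h) mul_scalar_mx -scalerA => ->.
by rewrite scalerA mulVf ?scale1r // (sn0 G).
Qed.

Lemma bicrossed_unique : exists! W2 : 'M[C]_(n * n),
  [/\ multiplicative_unitary W2 /\ multiplicity1 W2,
      fixedv W2 g, cofixedv W2 f,
      (forall x, Sset W2 x <-> Aff V e eh U f x) &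
      (forall y, hatSset W2 y <-> Bgg V e eh U g y)].
Proof.
exists W; split.
  split; [split | exact: W_fix | exact: W_cofix | | ].
  - exact: (munit_inv W_u1 W_u2 W_pentL).
  - exact: W_mult1.
  - by move=> x; rewrite Sset_WP AffP.
  - by move=> y; rewrite hatSset_WP BggP.
move=> W2 [[/munitP h1 _] h2 h3 h4 h5]; apply/esym; apply: W_unique => //.
  by move=> x /AffP /h4.
by move=> u v; apply/BggP/h5/hatSset_Rsl.
Qed.

End Pair.
Lemma bicrossed_theorem V e eh U f g :
  (0 < n)%N ->
  multiplicative_unitary V -> multiplicity1 V ->
  ip e e = 1 -> fixedv V e ->
  ip eh eh = 1 -> cofixedv V eh ->
  ip e eh = (sqrtC (n%:R : C))^-1 ->
  unitary_op U ->
  (forall om : {scalar 'M[C]_n}, U *m (slice_l om V *m e) = slice_l om (adj_op V) *m e) ->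
  presubgroup V e f -> presubgroup V e g ->
  ip f g = (sqrtC (n%:R : C))^-1 ->
  [/\ unital_star_subalg (Aff V e eh U f),
      unital_star_subalg (Bgg V e eh U g)
    & exists! W : 'M[C]_(n * n),
        [/\ multiplicative_unitary W /\ multiplicity1 W,
            fixedv W g, cofixedv W f,
            (forall x, Sset W x <-> Aff V e eh U f x)
          & (forall y, hatSset W y <-> Bgg V e eh U g y)]].
Proof.
set s := (sqrtC _)^-1 => n0 /munitP HV [xi [_ hxi]] e1 he eh1 heh es [U2 U1] hU pf pg fg.
have s0 : 0 < s by rewrite invr_gt0 sqrtC_gt0 ltr0n.
have sr : s^* = s by apply/CrealP; rewrite ger0_real // ltW.
have hl z : fixedv V z -> exists c, z = c *: e.
  have [c0 hc0] := proj1 (hxi e) he.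
  have c00 : c0 != 0.
    apply/eqP => c00; move: e1 (oner_neq0 C).
    by rewrite hc0 c00 scale0r ip0r => ->; rewrite eqxx.
  move=> /hxi [c ->]; exists (c / c0).
  by rewrite hc0 scalerA divfK.
have G : good s V e eh.
  by split=> //; apply: (cyclic_fixed n0 HV he heh e1 es sr (lt0r_neq0 s0) hl).
have K : kac s V e eh U.
  split=> // z; apply: ip2_ext => u w.
  by rewrite mulmxA -LE op2_Lsl -mulmxA -Lsl_slice hU Lsl_slice LE.
have [X hX] := canon_ex K pf pg fg.
have [X' hX'] := canon_ex (dualV_kac K) (dual_pre K pf) (dual_pre K pg) fg.
split.
- exact: (Aff_subalg K pf pg fg hX hX').
- exact: (Bgg_subalg K pf pg fg hX hX').
- exact: (bicrossed_unique K pf pg fg hX hX').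
Qed.

End Final.

Theorem theorem6p2 (R : realType) (n : nat)
  (V : 'M[R[i]]_(n * n)) (e ehat : 'cV[R[i]]_n) (U : 'M[R[i]]_n)
  (f g : 'cV[R[i]]_n) :
  (0 < n)%N ->
  multiplicative_unitary V -> multiplicity1 V ->
  ip e e = 1 -> fixedv V e ->
  ip ehat ehat = 1 -> cofixedv V ehat ->
  ip e ehat = (sqrtC (n%:R : R[i]))^-1 ->
  unitary_op U ->
  (forall om : {scalar 'M[R[i]]_n},
      U *m (slice_l om V *m e) = slice_l om (adj_op V) *m e) ->
  presubgroup V e f -> presubgroup V e g ->
  ip f g = (sqrtC (n%:R : R[i]))^-1 ->
  [/\ unital_star_subalg (Aff V e ehat U f),
      unital_star_subalg (Bgg V e ehat U g)
    & exists! W : 'M[R[i]]_(n * n),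
        [/\ multiplicative_unitary W /\ multiplicity1 W,
            fixedv W g, cofixedv W f,
            (forall x, (exists om : {scalar 'M[R[i]]_n}, x = slice_l om W)
                       <-> Aff V e ehat U f x)
          & (forall y, (exists om : {scalar 'M[R[i]]_n}, y = slice_r om W)
                       <-> Bgg V e ehat U g y)]].
Proof. exact: bicrossed_theorem. Qed.
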